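(* The following conditions are all equivalent in $\mathbf{ZF}$: (i) $\mathbf{CMC}$, the axiom of countable multiple choice; (ii) every Hausdorff first countable topological space is a $k$-space; (iii) every metrizable topological space is a $k$-space.
   Context: All work is in $\mathbf{ZF}$ (Zermelo–Fraenkel set theory without the axiom of choice). $\mathbf{CMC}$ is the statement: for every collection $\{A_n : n\in\omega\}$ of non-empty sets there exists a collection $\{F_n : n\in\omega\}$ of non-empty finite sets such that $F_n\subseteq A_n$ for each $n\in\omega$. Compact means that every open cover has a finite subcover. A Hausdorff space $Z$ is called a $k$-space if, for every $A\subseteq Z$, $A$ is closed in $Z$ if and only if $A\cap K$ is closed in $Z$ for each compact set $K$ in $Z$. *)

(* Defs.v *)
(* "Equivalent in ZF" is read model-theoretically: the statement is proved for
   every structure (M, E) satisfying the first-order axioms of ZF, all notions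
   being relativized to M.  Every definition below quantifies over elements of M
   only (never over predicates or functions on M), so it is the interpretation
   in (M, E) of a first-order formula of set theory.  In particular a choice
   principle available in the ambient logic gives no choice inside M. *)

Set Implicit Arguments.

(* First-order formulas in the language {∈, =}; variables are de Bruijn indices. *)
Inductive form : Type :=
| f_mem (i j : nat)
| f_eq (i j : nat)
| f_false
| f_imp (p q : form)
| f_and (p q : form)
| f_or (p q : form)
| f_all (p : form)
| f_ex (p : form).

Definition scons {M : Type} (a : M) (rho : nat -> M) : nat -> M :=
  fun n => match n with O => a | S k => rho k end.

Section SetTheory.

Context {M : Type} (E : M -> M -> Prop).

Local Notation "x ∈ y" := (E x y) (at level 70).
Local Notation "x ∉ y" := (~ E x y) (at level 70).

Fixpoint sat (rho : nat -> M) (p : form) : Prop :=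
  match p with
  | f_mem i j => rho i ∈ rho j
  | f_eq i j => rho i = rho j
  | f_false => False
  | f_imp p q => sat rho p -> sat rho q
  | f_and p q => sat rho p /\ sat rho q
  | f_or p q => sat rho p \/ sat rho q
  | f_all p => forall a, sat (scons a rho) p
  | f_ex p => exists a, sat (scons a rho) p
  end.

Definition subset (x y : M) : Prop := forall z, z ∈ x -> z ∈ y.
Definition inhabited (x : M) : Prop := exists z, z ∈ x.
Definition is_empty (x : M) : Prop := forall z, z ∉ x.
Definition is_upair (p x y : M) : Prop := forall z, z ∈ p <-> z = x \/ z = y.
Definition is_union (u x : M) : Prop :=
  forall z, z ∈ u <-> exists y, y ∈ x /\ z ∈ y.
Definition is_inter (u x y : M) : Prop := forall z, z ∈ u <-> z ∈ x /\ z ∈ y.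
Definition is_diff (u x y : M) : Prop := forall z, z ∈ u <-> z ∈ x /\ z ∉ y.
Definition is_succ (s x : M) : Prop := forall z, z ∈ s <-> z ∈ x \/ z = x.
Definition inductive (w : M) : Prop :=
  (exists e, is_empty e /\ e ∈ w) /\
  (forall x, x ∈ w -> exists s, is_succ s x /\ s ∈ w).

(* Separation and Replacement are the first-order schemas; [rho] carries the
   parameters. *)
Record ZF : Prop := {
  zf_extensionality : forall x y, (forall z, z ∈ x <-> z ∈ y) -> x = y;
  zf_foundation : forall x, inhabited x ->
    exists y, y ∈ x /\ forall z, ~ (z ∈ x /\ z ∈ y);
  zf_pairing : forall x y, exists p, is_upair p x y;
  zf_union : forall x, exists u, is_union u x;
  zf_power : forall x, exists p, forall z, z ∈ p <-> subset z x;
  zf_infinity : exists w, inductive w;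
  zf_separation : forall (p : form) (rho : nat -> M) (x : M),
    exists y, forall z, z ∈ y <-> z ∈ x /\ sat (scons z rho) p;
  zf_replacement : forall (p : form) (rho : nat -> M) (x : M),
    (forall a, a ∈ x -> exists! b, sat (scons a (scons b rho)) p) ->
    exists y, forall b,
      b ∈ y <-> exists a, a ∈ x /\ sat (scons a (scons b rho)) p
}.

(* p = (x, y), the Kuratowski pair {{x}, {x, y}}. *)
Definition is_opair (p x y : M) : Prop :=
  forall z, z ∈ p <-> is_upair z x x \/ is_upair z x y.

Definition is_prod (p x y : M) : Prop :=
  forall u, u ∈ p <-> exists a b, a ∈ x /\ b ∈ y /\ is_opair u a b.

(* f(x) = y *)
Definition app (f x y : M) : Prop := exists p, is_opair p x y /\ p ∈ f.

Definition fun_on (f a : M) : Prop :=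
  (forall p, p ∈ f -> exists x y, x ∈ a /\ is_opair p x y) /\
  (forall x, x ∈ a -> exists! y, app f x y).

Definition injective (f : M) : Prop :=
  forall x x' y, app f x y -> app f x' y -> x = x'.

(* Natural numbers of M: finite von Neumann ordinals. *)
Definition is_nat (n : M) : Prop := forall w, inductive w -> n ∈ w.
Definition is_omega (w : M) : Prop := forall n, n ∈ w <-> is_nat n.

Definition finite (x : M) : Prop :=
  exists n f, is_nat n /\ fun_on f n /\ injective f /\
    (forall y, y ∈ x <-> exists i, app f i y).

(* Countable includes finite. *)
Definition countable (x : M) : Prop :=
  exists f, fun_on f x /\ injective f /\ (forall a n, app f a n -> is_nat n).

Definition CMC : Prop :=
  forall w A, is_omega w -> fun_on A w ->
    (forall n a, app A n a -> inhabited a) ->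
    exists F, fun_on F w /\
      forall n a b, app A n a -> app F n b ->
        inhabited b /\ finite b /\ subset b a.

(* T is (the set of open sets of) a topology on X. *)
Definition topology (X T : M) : Prop :=
  (forall U, U ∈ T -> subset U X) /\
  (forall e, is_empty e -> e ∈ T) /\
  X ∈ T /\
  (forall U V W, U ∈ T -> V ∈ T -> is_inter W U V -> W ∈ T) /\
  (forall C U, subset C T -> is_union U C -> U ∈ T).

Definition closed (X T A : M) : Prop :=
  subset A X /\ forall U, is_diff U X A -> U ∈ T.

Definition hausdorff (X T : M) : Prop :=
  forall x y, x ∈ X -> y ∈ X -> x <> y ->
    exists U V, U ∈ T /\ V ∈ T /\ x ∈ U /\ y ∈ V /\
      forall z, ~ (z ∈ U /\ z ∈ V).

Definition first_countable (X T : M) : Prop :=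
  forall x, x ∈ X ->
    exists B, countable B /\
      (forall U, U ∈ B -> U ∈ T /\ x ∈ U) /\
      (forall V, V ∈ T -> x ∈ V -> exists U, U ∈ B /\ subset U V).

Definition covers (C K : M) : Prop :=
  forall x, x ∈ K -> exists U, U ∈ C /\ x ∈ U.

Definition compact (X T K : M) : Prop :=
  subset K X /\
  forall C, subset C T -> covers C K ->
    exists F, subset F C /\ finite F /\ covers F K.

Definition k_space (X T : M) : Prop :=
  topology X T /\ hausdorff X T /\
  forall A, subset A X ->
    (closed X T A <->
     forall K B, compact X T K -> is_inter B A K -> closed X T B).

(* Arithmetic on the natural numbers of M, by recursion on the second argument. *)
Definition nat_add (m n k : M) : Prop :=
  is_nat m /\ is_nat n /\
  exists w f, is_omega w /\ fun_on f w /\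
    (forall e, is_empty e -> app f e m) /\
    (forall i i' j j', is_succ i' i -> is_succ j' j -> app f i j -> app f i' j') /\
    app f n k.

Definition nat_mul (m n k : M) : Prop :=
  is_nat m /\ is_nat n /\
  exists w f, is_omega w /\ fun_on f w /\
    (forall e, is_empty e -> app f e e) /\
    (forall i i' j j', is_succ i' i -> nat_add j m j' -> app f i j -> app f i' j') /\
    app f n k.

(* The triple q = ((a, b), c) of natural numbers, c <> 0, is a fraction denoting
   the rational number (a - b) / c. *)
Definition frac (q a b c : M) : Prop :=
  is_nat a /\ is_nat b /\ is_nat c /\ inhabited c /\
  exists u, is_opair u a b /\ is_opair q u c.

Definition is_frac (q : M) : Prop := exists a b c, frac q a b c.

(* (a - b) / c < (a' - b') / c'  iff  a c' + b' c < a' c + b c'. *)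
Definition frac_lt (q q' : M) : Prop :=
  exists a b c a' b' c', frac q a b c /\ frac q' a' b' c' /\
  exists ac' bc' a'c b'c s t,
    nat_mul a c' ac' /\ nat_mul b c' bc' /\
    nat_mul a' c a'c /\ nat_mul b' c b'c /\
    nat_add ac' b'c s /\ nat_add a'c bc' t /\ s ∈ t.

(* (a - b) / c + (a' - b') / c' = ((a c' + a' c) - (b c' + b' c)) / (c c'). *)
Definition frac_add (q q' r : M) : Prop :=
  exists a b c a' b' c', frac q a b c /\ frac q' a' b' c' /\
  exists ac' bc' a'c b'c s t d,
    nat_mul a c' ac' /\ nat_mul b c' bc' /\
    nat_mul a' c a'c /\ nat_mul b' c b'c /\
    nat_add ac' a'c s /\ nat_add bc' b'c t /\ nat_mul c c' d /\ frac r s t d.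

(* Dedekind cuts without maximum.  The cuts are sets of fractions rather than of
   rational numbers; being closed downwards without maximum, such a set contains
   with a fraction every other fraction of the same value, so these are exactly
   the cuts of the field of rational numbers. *)
Definition is_real (r : M) : Prop :=
  (forall q, q ∈ r -> is_frac q) /\
  inhabited r /\
  (exists q, is_frac q /\ q ∉ r) /\
  (forall q q', q ∈ r -> frac_lt q' q -> q' ∈ r) /\
  (forall q, q ∈ r -> exists q', q' ∈ r /\ frac_lt q q').

Definition real_le (r s : M) : Prop := is_real r /\ is_real s /\ subset r s.
Definition real_lt (r s : M) : Prop := real_le r s /\ r <> s.

(* The cut of all fractions (a - b) / c < 0, i.e. with a < b. *)
Definition real_zero (z : M) : Prop :=
  forall q, q ∈ z <-> exists a b c, frac q a b c /\ a ∈ b.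

(* The cut {q | q < x + y for some x in r, y in s}.  As r has no maximum this is
   the set of all sums x + y, up to the choice of the fractions denoting them. *)
Definition real_add (r s t : M) : Prop :=
  is_real r /\ is_real s /\
  forall q, q ∈ t <->
    exists x y z, x ∈ r /\ y ∈ s /\ frac_add x y z /\ frac_lt q z.

(* d(x, y) = r *)
Definition dist (d x y r : M) : Prop := exists p, is_opair p x y /\ app d p r.

Definition metric (X d : M) : Prop :=
  (exists P, is_prod P X X /\ fun_on d P) /\
  (forall x y r, dist d x y r -> is_real r) /\
  (forall x y r z, dist d x y r -> real_zero z -> real_le z r) /\
  (forall x y r z, dist d x y r -> real_zero z -> (r = z <-> x = y)) /\
  (forall x y r, dist d x y r -> dist d y x r) /\
  (forall x y z r s t u, dist d x z r -> dist d x y s -> dist d y z t ->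
     real_add s t u -> real_le r u).

(* The topology T on X is the one induced by some metric. *)
Definition metrizable (X T : M) : Prop :=
  topology X T /\
  exists d, metric X d /\
    forall U, U ∈ T <->
      subset U X /\
      forall x, x ∈ U ->
        exists z e, real_zero z /\ real_lt z e /\
          forall y r, y ∈ X -> dist d x y r -> real_lt r e -> y ∈ U.

End SetTheory.

(* Main.v *)
(* A point x in the closure of A ⊆ X with a decreasing countable base U n yields the non-empty
   sets A ∩ U n.  If multiple choice picks finite F n ⊆ A ∩ U n, then {x} ∪ ⋃ F n is compact
   and meets A in a set that is not closed.

   Conversely, given non-empty sets A n, let X consist of the choice functions s for the initial
   segments of the family, with distance max (1/|s|, 1/|t|) between s ≠ t, where 1/0 counts
   as 0.  The empty function is the only non-isolated point, so if X is a k-space, some compact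
   K has members of arbitrarily large length.  The members of a given length n > 0 are isolated
   and form a closed set, so K has finitely many of them; evaluating at i those of the least
   length greater than i gives a finite non-empty subset of A i.

   Everything takes place inside the model, so each set that is formed or inducted on must be
   given by a first-order formula with parameters; the tactic definable finds the formula. *)

From Stdlib Require Import Classical ClassicalEpsilon ProofIrrelevance PeanoNat Ring.
Require Import Defs.

Set Implicit Arguments.
Unset Strict Implicit.

(** Finite sets are compact, so finite sets shrinking to x serve in (ii) as well as a convergent
    sequence would; this is why multiple choice suffices there. Passing from (ii) to (iii) must
    itself avoid choice: balls of radius 1/n are numbered by their least n. For the converse,
    placing the sets A n themselves at distance 1/n from a centre would give a compact K that meets
    infinitely many A n, not every one. A choice function on an initial segment carries a value for
    every smaller index, so one long member of K serves all shorter indices. Such functions of each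
    length exist by induction, and taking a least length makes the selection unique, so no choice is
    spent. The maximum of inverse lengths is an ultrametric; the triangle inequality then only needs
    that a sum of non-negative reals dominates both summands. A cut r satisfies r ≤ q exactly when
    the fraction q is not in r. Distances are compared through such non-memberships, which keeps
    sums of cuts out of the topology. The ambient epsilon operator only names sets that the axioms
    determine uniquely, so it adds no choice to the model. *)

Section Model.

Context {M : Type} (E : M -> M -> Prop).

Local Notation "x ∈ y" := (E x y) (at level 70).
Local Notation "x ∉ y" := (~ E x y) (at level 70).
Local Notation env := (nat -> M).
Local Notation shift rho := (fun n : nat => rho (S n)).
Local Notation sat := (sat E).

(** * Definability with parameters *)

(** Renaming under a quantifier: index 0 is the bound variable and must stay fixed. *)
Definition up (f : nat -> nat) (n : nat) : nat :=
  match n with O => O | S k => S (f k) end.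

Fixpoint rename (f : nat -> nat) (p : form) : form :=
  match p with
  | f_mem i j => f_mem (f i) (f j)
  | f_eq i j => f_eq (f i) (f j)
  | f_false => f_false
  | f_imp p q => f_imp (rename f p) (rename f q)
  | f_and p q => f_and (rename f p) (rename f q)
  | f_or p q => f_or (rename f p) (rename f q)
  | f_all p => f_all (rename (up f) p)
  | f_ex p => f_ex (rename (up f) p)
  end.

Lemma sat_rename (p : form) : forall (f : nat -> nat) (rho sigma : env),
  (forall n, rho (f n) = sigma n) -> (sat rho (rename f p) <-> sat sigma p).
Proof.
  assert (Hup : forall f (rho sigma : env) a, (forall n, rho (f n) = sigma n) ->
    forall n, scons a rho (up f n) = scons a sigma n) by (intros ???? H [|n]; simpl; auto).
  induction p as [i j|i j| |p IHp q IHq|p IHp q IHq|p IHp q IHq|p IHp|p IHp];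
    intros f rho sigma H; simpl.
  - rewrite !H; tauto.
  - rewrite !H; tauto.
  - tauto.
  - rewrite (IHp _ _ _ H), (IHq _ _ _ H); tauto.
  - rewrite (IHp _ _ _ H), (IHq _ _ _ H); tauto.
  - rewrite (IHp _ _ _ H), (IHq _ _ _ H); tauto.
  - split; intros G a; specialize (G a); revert G; apply (IHp _ _ _ (Hup _ _ _ a H)).
  - split; intros [a G]; exists a; revert G; apply (IHp _ _ _ (Hup _ _ _ a H)).
Qed.

(* An atom is a variable or a parameter from the model. *)
Definition atom_val (rho : env) (t : nat + M) : M :=
  match t with inl i => rho i | inr c => c end.

(** Predicates are those of the ambient logic, so definability is a property to be proved. Though
    [s] is defined on all indices, [p] mentions only finitely many, hence this is definability with
    finitely many parameters. *)
Definition pdef (P : env -> Prop) : Prop :=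
  exists (p : form) (s : nat -> nat + M),
    forall rho, sat (fun n => atom_val rho (s n)) p <-> P rho.

Lemma pdef_ext (P Q : env -> Prop) : (forall rho, P rho <-> Q rho) -> pdef P -> pdef Q.
Proof.
  intros H (p & s & Hp). exists p, s. intros rho. rewrite Hp. apply H.
Qed.

Lemma pdef_substitute (P : env -> Prop) (t : nat -> nat + M) :
  pdef P -> pdef (fun rho => P (fun n => atom_val rho (t n))).
Proof.
  intros (p & s & Hp).
  (* Renaming by the identity exchanges pointwise equal environments without function
     extensionality. *)
  exists (rename (fun n => n) p),
    (fun n => match s n with inl i => t i | inr c => inr c end).
  intros rho. rewrite <- Hp. apply sat_rename. intros n. destruct (s n); reflexivity.
Qed.

Lemma pdef_binary (op : form -> form -> form) (o : Prop -> Prop -> Prop)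
    (P Q : env -> Prop) :
  (forall rho p q, sat rho (op p q) <-> o (sat rho p) (sat rho q)) ->
  (forall A A' B B', (A <-> A') -> (B <-> B') -> (o A B <-> o A' B')) ->
  pdef P -> pdef Q -> pdef (fun rho => o (P rho) (Q rho)).
Proof.
  intros Hop Ho (p & s & Hp) (q & t & Hq).
  (* The atoms of [p] move to even indices and those of [q] to odd ones, so the two assignments can
     be merged. *)
  exists (op (rename (fun n => 2 * n) p) (rename (fun n => S (2 * n)) q)),
    (fun n => if Nat.even n then s (Nat.div2 n) else t (Nat.div2 n)).
  intros rho. rewrite Hop. apply Ho.
  - rewrite <- Hp. apply sat_rename. intros n.
    rewrite Nat.even_mul, Nat.div2_double. reflexivity.
  - rewrite <- Hq. apply sat_rename. intros n.
    rewrite Nat.even_succ, Nat.odd_mul, Nat.div2_succ_double. reflexivity.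
Qed.

Lemma pdef_and (P Q : env -> Prop) : pdef P -> pdef Q -> pdef (fun rho => P rho /\ Q rho).
Proof. apply (@pdef_binary f_and and); simpl; tauto. Qed.

Lemma pdef_or (P Q : env -> Prop) : pdef P -> pdef Q -> pdef (fun rho => P rho \/ Q rho).
Proof. apply (@pdef_binary f_or or); simpl; tauto. Qed.

Lemma pdef_imp (P Q : env -> Prop) : pdef P -> pdef Q -> pdef (fun rho => P rho -> Q rho).
Proof. apply (@pdef_binary f_imp (fun A B => A -> B)); simpl; tauto. Qed.

Lemma pdef_false : pdef (fun _ => False).
Proof. exists f_false, inl. simpl. tauto. Qed.

Lemma pdef_not (P : env -> Prop) : pdef P -> pdef (fun rho => ~ P rho).
Proof. intros H. exact (pdef_imp H pdef_false). Qed.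

Lemma pdef_iff (P Q : env -> Prop) : pdef P -> pdef Q -> pdef (fun rho => P rho <-> Q rho).
Proof. intros. apply pdef_and; apply pdef_imp; assumption. Qed.

(** [s] may send several indices to variable 0, while a quantifier binds index 0 only. All these
    indices are collapsed to 0, the others move up by one, and the variables in [s] are lowered
    accordingly. *)
Lemma sat_bind (p : form) (s : nat -> nat + M) (rho : env) (a : M) :
  sat (scons a (fun n => atom_val rho
         match s n with inl (S i) => inl i | inl O => inl O | inr c => inr c end))
      (rename (fun n => match s n with inl O => O | _ => S n end) p) <->
  sat (fun n => atom_val (scons a rho) (s n)) p.
Proof.
  apply sat_rename. intros n. destruct (s n) as [[|i]|c] eqn:H; simpl; rewrite ?H; reflexivity.
Qed.

Lemma pdef_all (Q : M -> env -> Prop) :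
  pdef (fun rho => Q (rho 0) (shift rho)) -> pdef (fun rho => forall a, Q a rho).
Proof.
  intros (p & s & Hp). eexists (f_all _), _. intros rho. simpl. split.
  - intros H a. apply (Hp (scons a rho)), sat_bind, H.
  - intros H a. apply sat_bind, (Hp (scons a rho)), H.
Qed.

Lemma pdef_ex (Q : M -> env -> Prop) :
  pdef (fun rho => Q (rho 0) (shift rho)) -> pdef (fun rho => exists a, Q a rho).
Proof.
  intros (p & s & Hp). eexists (f_ex _), _. intros rho. simpl. split.
  - intros [a H]. exists a. apply (Hp (scons a rho)), sat_bind, H.
  - intros [a H]. exists a. apply sat_bind, (Hp (scons a rho)), H.
Qed.

(** The language has no function symbols, so an operation counts as definable when its graph is;
    index 0 holds the value. *)
Definition tm (v : env -> M) : Prop := pdef (fun rho => rho 0 = v (shift rho)).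

Lemma tm_var (i : nat) : tm (fun rho => rho i).
Proof. exists (f_eq 0 (S i)), inl. simpl. tauto. Qed.

Lemma tm_const (c : M) : tm (fun _ => c).
Proof.
  exists (f_eq 0 1), (fun n => match n with O => inl O | _ => inr c end). simpl. tauto.
Qed.

Lemma tm_shift (v : env -> M) : tm v -> tm (fun rho => v (shift rho)).
Proof.
  intros H. exact (pdef_substitute (fun n => match n with O => inl O | S k => inl (S (S k)) end) H).
Qed.

(** A defined operation is eliminated in the usual way, by naming its value with an existential
    quantifier. *)
Lemma pdef_subst (Q : M -> env -> Prop) (v : env -> M) :
  tm v -> pdef (fun rho => Q (rho 0) (shift rho)) -> pdef (fun rho => Q (v rho) rho).
Proof.
  intros Hv HQ. apply pdef_ext with (fun rho => exists y, y = v rho /\ Q y rho).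
  - intros rho. split; [intros (y & -> & H); exact H | eauto].
  - apply (@pdef_ex (fun y rho => y = v rho /\ Q y rho)). apply pdef_and; assumption.
Qed.

Lemma pdef_subst1 (R : M -> Prop) (u : env -> M) :
  pdef (fun rho => R (rho 0)) -> tm u -> pdef (fun rho => R (u rho)).
Proof. intros HR Hu. exact (pdef_subst (Q := fun a _ => R a) Hu HR). Qed.

Lemma pdef_subst2 (R : M -> M -> Prop) (u v : env -> M) :
  pdef (fun rho => R (rho 0) (rho 1)) -> tm u -> tm v -> pdef (fun rho => R (u rho) (v rho)).
Proof.
  intros HR Hu Hv. apply (pdef_subst (Q := fun b rho => R (u rho) b) Hv).
  apply (pdef_subst (Q := fun a rho => R a (rho 0)) (tm_shift Hu) HR).
Qed.

Lemma pdef_subst3 (R : M -> M -> M -> Prop) (u v w : env -> M) :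
  pdef (fun rho => R (rho 0) (rho 1) (rho 2)) ->
  tm u -> tm v -> tm w -> pdef (fun rho => R (u rho) (v rho) (w rho)).
Proof.
  intros HR Hu Hv Hw. apply (pdef_subst (Q := fun c rho => R (u rho) (v rho) c) Hw).
  apply (pdef_subst (Q := fun b rho => R (u (shift rho)) b (rho 0)) (tm_shift Hv)).
  apply (pdef_subst (Q := fun a rho => R a (rho 0) (rho 1)) (tm_shift (tm_shift Hu)) HR).
Qed.

Lemma pdef_mem (u v : env -> M) : tm u -> tm v -> pdef (fun rho => u rho ∈ v rho).
Proof. apply pdef_subst2. exists (f_mem 0 1), inl. simpl. tauto. Qed.

Lemma pdef_eq (u v : env -> M) : tm u -> tm v -> pdef (fun rho => u rho = v rho).
Proof. apply pdef_subst2. exists (f_eq 0 1), inl. simpl. tauto. Qed.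

Lemma tm_op1 (f : M -> M) (u : env -> M) :
  tm (fun rho => f (rho 0)) -> tm u -> tm (fun rho => f (u rho)).
Proof.
  intros Hf Hu.
  exact (pdef_subst (Q := fun a rho => rho 0 = f a) (tm_shift Hu)
    (pdef_substitute (fun n => inl (match n with O => 1 | _ => 0 end)) Hf)).
Qed.

Lemma tm_op2 (f : M -> M -> M) (u v : env -> M) :
  tm (fun rho => f (rho 0) (rho 1)) -> tm u -> tm v -> tm (fun rho => f (u rho) (v rho)).
Proof.
  intros Hf Hu Hv.
  apply (pdef_subst (Q := fun b rho => rho 0 = f (u (shift rho)) b) (tm_shift Hv)).
  apply (pdef_subst (Q := fun a rho => rho 1 = f a (rho 0)) (tm_shift (tm_shift Hu))).
  exact (pdef_substitute (fun n => inl (match n with 0 => 2 | 1 => 0 | _ => 1 end)) Hf).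
Qed.

(* def_op and def_rel are extended below with each operation and relation shown definable. *)
Ltac def_op := fail.
Ltac def_rel := fail.

(** Recursion on the shape of the predicate. Definability hypotheses about an ambient function or
    relation in the context supply the cases not built from known operations. *)
Ltac definable :=
  cbv beta;
  lazymatch goal with
  | H : tm (fun rho => ?f (rho 0)) |- tm (fun rho => ?f _) => apply (tm_op1 H); definable
  | |- tm _ => first [assumption | simple apply tm_const | simple apply tm_var | def_op; definable]
  | |- pdef (fun rho => _ /\ _) => apply pdef_and; definable
  | |- pdef (fun rho => _ \/ _) => apply pdef_or; definable
  | |- pdef (fun rho => _ <-> _) => apply pdef_iff; definable
  | |- pdef (fun rho => ~ _) => apply pdef_not; definable
  | |- pdef (fun rho => False) => apply pdef_false
  | |- pdef (fun rho => @?P rho -> @?Q rho) => apply (@pdef_imp P Q); definable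
  | |- pdef (fun rho => forall a : M, @?Q rho a) =>
      apply (@pdef_all (fun a rho => Q rho a)); definable
  | |- pdef (fun rho => exists! a, @?Q rho a) => unfold unique; definable
  | |- pdef (fun rho => exists a, @?Q rho a) =>
      apply (@pdef_ex (fun a rho => Q rho a)); definable
  | |- pdef (fun rho => _ = _) => apply pdef_eq; definable
  | |- pdef (fun rho => E _ _) => apply pdef_mem; definable
  | H : pdef (fun rho => ?R (rho 0)) |- pdef (fun rho => ?R _) =>
      apply (@pdef_subst1 R _ H); definable
  | H : pdef (fun rho => ?R (rho 0) (rho 1)) |- pdef (fun rho => ?R _ _) =>
      apply (@pdef_subst2 R _ _ H); definable
  | |- pdef _ => first [assumption | def_rel; definable]
  end.

(** * Set operations *)

Hypothesis HZF : ZF E.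

(** Applied below only to descriptions that extensionality makes unique, so it makes no choice
    inside the model. The axiom of infinity supplies the inhabitant that [epsilon] asks for. *)
Definition the (P : M -> Prop) : M :=
  epsilon (match zf_infinity HZF with ex_intro _ w _ => inhabits w end) P.

Lemma theP (P : M -> Prop) : (exists x, P x) -> P (the P).
Proof. apply epsilon_spec. Qed.

Lemma set_ext (x y : M) : (forall z, z ∈ x <-> z ∈ y) -> x = y.
Proof. apply (zf_extensionality HZF). Qed.

Lemma tm_spec (v : env -> M) (R : M -> env -> Prop) :
  (forall y rho, y = v rho <-> R y rho) -> pdef (fun rho => R (rho 0) (shift rho)) -> tm v.
Proof. intros H. apply pdef_ext. intros rho. symmetry. apply H. Qed.

(** By extensionality, y is the value of v exactly when y has the members described by R, which is
    again first-order. *)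
Lemma tm_ext (v : env -> M) (R : M -> env -> Prop) :
  (forall y rho, y ∈ v rho <-> R y rho) -> pdef (fun rho => R (rho 0) (shift rho)) -> tm v.
Proof.
  intros H HR. apply tm_spec with (R := fun y rho => forall z, z ∈ y <-> R z rho).
  - intros y rho. split; [intros -> z; apply H |].
    intros G. apply set_ext. intros z. rewrite G, H. tauto.
  - apply (@pdef_all (fun z rho => z ∈ rho 0 <-> R z (shift rho))).
    apply pdef_iff; [definable |].
    exact (pdef_substitute (fun n => inl (match n with O => O | S k => S (S k) end)) HR).
Qed.

(** Total in an arbitrary ambient predicate, but the expected members are guaranteed only when [P]
    is definable. *)
Definition sep (x : M) (P : M -> Prop) : M := the (fun y => forall z, z ∈ y <-> z ∈ x /\ P z).

Lemma pdef_fix (P : M -> env -> Prop) (rho : env) :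
  pdef (fun rho => P (rho 0) (shift rho)) -> pdef (fun sigma => P (sigma 0) rho).
Proof.
  exact (pdef_substitute (fun n => match n with O => inl O | S k => inr (rho k) end)).
Qed.

Lemma sepP (x : M) (P : M -> Prop) : pdef (fun rho => P (rho 0)) ->
  forall z, z ∈ sep x P <-> z ∈ x /\ P z.
Proof.
  intros HP. apply (theP (P := fun y => forall z, z ∈ y <-> z ∈ x /\ P z)).
  apply (pdef_substitute (fun _ => inl 0)) in HP as (p & s & Hp). simpl in Hp.
  (* The formula is evaluated at the constant environment z, so every variable may be identified
     with the single variable of the schema; the parameters keep separate indices. *)
  destruct (zf_separation HZF (rename (fun n => match s n with inl _ => O | _ => S n end) p)
    (fun n => atom_val (fun _ => x) (s n)) x) as [y Hy].
  exists y. intros z. rewrite Hy, <- (Hp (fun _ => z)).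
  erewrite sat_rename; [reflexivity |].
  intros n. simpl. destruct (s n) eqn:Hn; simpl; rewrite ?Hn; reflexivity.
Qed.

Lemma tm_sep (u : env -> M) (P : env -> M -> Prop) :
  tm u -> pdef (fun rho => P (shift rho) (rho 0)) -> tm (fun rho => sep (u rho) (P rho)).
Proof.
  intros Hu HP. apply tm_ext with (fun y rho => y ∈ u rho /\ P rho y).
  - intros y rho. apply sepP, (pdef_fix (P := fun z rho => P rho z) rho HP).
  - apply pdef_and; [apply pdef_mem; [definable | exact (tm_shift Hu)] | exact HP].
Qed.

Definition upair (x y : M) : M := the (fun p => is_upair E p x y).

Lemma upairP (x y z : M) : z ∈ upair x y <-> z = x \/ z = y.
Proof. apply (theP (P := fun p => is_upair E p x y)), (zf_pairing HZF). Qed.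

Definition un (x : M) : M := the (fun u => is_union E u x).

Lemma unP (x z : M) : z ∈ un x <-> exists y, y ∈ x /\ z ∈ y.
Proof. apply (theP (P := fun u => is_union E u x)), (zf_union HZF). Qed.

Definition pow (x : M) : M := the (fun p => forall z, z ∈ p <-> subset E z x).

Lemma powP (x z : M) : z ∈ pow x <-> subset E z x.
Proof. apply (theP (P := fun p => forall z, z ∈ p <-> subset E z x)), (zf_power HZF). Qed.

Lemma tm_upair (u v : env -> M) : tm u -> tm v -> tm (fun rho => upair (u rho) (v rho)).
Proof.
  apply tm_op2. apply (tm_ext (R := fun y rho => y = rho 0 \/ y = rho 1)); [|definable].
  intros. apply upairP.
Qed.

Lemma tm_un (u : env -> M) : tm u -> tm (fun rho => un (u rho)).
Proof.
  apply tm_op1. apply (tm_ext (R := fun z rho => exists y, y ∈ rho 0 /\ z ∈ y)); [|definable].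
  intros. apply unP.
Qed.

Lemma tm_pow (u : env -> M) : tm u -> tm (fun rho => pow (u rho)).
Proof.
  apply tm_op1. apply (tm_ext (R := fun z rho => forall y, y ∈ z -> y ∈ rho 0)); [|definable].
  intros. apply powP.
Qed.

Ltac def_op ::= first
  [ simple apply tm_sep | simple apply tm_upair | simple apply tm_un | simple apply tm_pow ].

Definition emp : M := the (is_empty E).

Lemma empP (z : M) : z ∉ emp.
Proof.
  revert z. apply (theP (P := is_empty E)).
  destruct (zf_infinity HZF) as (w & (e & He & _) & _). eauto.
Qed.

Definition sing (x : M) : M := upair x x.
Definition bun (x y : M) : M := un (upair x y).
Definition suc (x : M) : M := bun x (sing x).
Definition opair (x y : M) : M := upair (sing x) (upair x y).

Lemma singP (x z : M) : z ∈ sing x <-> z = x.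
Proof. unfold sing. rewrite upairP. tauto. Qed.

Lemma bunP (x y z : M) : z ∈ bun x y <-> z ∈ x \/ z ∈ y.
Proof.
  unfold bun. rewrite unP. split.
  - intros (u & [-> | ->] %upairP & H); auto.
  - intros [H | H]; [exists x | exists y]; rewrite upairP; auto.
Qed.

Lemma sucP (x z : M) : z ∈ suc x <-> z ∈ x \/ z = x.
Proof. unfold suc. rewrite bunP, singP. tauto. Qed.

Lemma upair_inj_r (x y z : M) : upair x y = upair x z -> y = z.
Proof.
  intros H.
  assert (Hy : y ∈ upair x z) by (rewrite <- H, upairP; auto).
  assert (Hz : z ∈ upair x y) by (rewrite H, upairP; auto).
  rewrite upairP in *. intuition congruence.
Qed.

Lemma sing_eq_upair (x y z : M) : sing x = upair y z -> x = y /\ x = z.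
Proof.
  intros H.
  assert (Hy : y ∈ sing x) by (rewrite H, upairP; auto).
  assert (Hz : z ∈ sing x) by (rewrite H, upairP; auto).
  rewrite singP in *. auto.
Qed.

Lemma opair_inj (x y x' y' : M) : opair x y = opair x' y' -> x = x' /\ y = y'.
Proof.
  intros H. assert (x = x') as <-.
  { assert (Hx : sing x ∈ opair x' y') by (rewrite <- H; apply upairP; auto).
    apply upairP in Hx as [Hx | Hx]; apply sing_eq_upair in Hx; tauto. }
  split; [reflexivity |]. apply upair_inj_r in H. apply upair_inj_r in H. exact H.
Qed.

Lemma is_emptyE (x : M) : is_empty E x <-> x = emp.
Proof.
  split; [|intros -> z; apply empP].
  intros H. apply set_ext. intros z. split; intros Hz; [case (H z Hz) | case (empP Hz)].
Qed.

Lemma is_upairE (p x y : M) : is_upair E p x y <-> p = upair x y.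
Proof.
  split; [|intros -> z; apply upairP].
  intros H. apply set_ext. intros z. rewrite (H z), upairP. tauto.
Qed.

Lemma is_succE (s x : M) : is_succ E s x <-> s = suc x.
Proof.
  split; [|intros -> z; apply sucP].
  intros H. apply set_ext. intros z. rewrite (H z), sucP. tauto.
Qed.

Lemma is_opairE (p x y : M) : is_opair E p x y <-> p = opair x y.
Proof.
  unfold is_opair. split.
  - intros H. apply set_ext. intros z. unfold opair, sing.
    rewrite (H z), upairP, !is_upairE. tauto.
  - intros -> z. unfold opair, sing. rewrite upairP, !is_upairE. tauto.
Qed.

Lemma inhabitedE (x : M) : inhabited E x <-> x <> emp.
Proof.
  rewrite <- is_emptyE. unfold inhabited, is_empty. split; [firstorder |].
  intros H. apply NNPP. firstorder.
Qed.

Lemma tm_sing (u : env -> M) : tm u -> tm (fun rho => sing (u rho)).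
Proof. unfold sing. intros. definable. Qed.

Lemma tm_bun (u v : env -> M) : tm u -> tm v -> tm (fun rho => bun (u rho) (v rho)).
Proof. unfold bun. intros. definable. Qed.

Lemma tm_suc (u : env -> M) : tm u -> tm (fun rho => suc (u rho)).
Proof. apply tm_op1. unfold suc, bun, sing. definable. Qed.

Lemma tm_opair (u v : env -> M) : tm u -> tm v -> tm (fun rho => opair (u rho) (v rho)).
Proof. apply tm_op2. unfold opair, sing. definable. Qed.

Ltac def_op_pair := first
  [ simple apply tm_sep | simple apply tm_upair | simple apply tm_un | simple apply tm_pow
  | simple apply tm_sing | simple apply tm_bun | simple apply tm_suc | simple apply tm_opair ].
Ltac def_op ::= def_op_pair.

Definition prd (x y : M) : M :=
  sep (pow (pow (bun x y))) (fun p => exists a b, a ∈ x /\ b ∈ y /\ p = opair a b).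

Lemma prdP (x y p : M) : p ∈ prd x y <-> exists a b, a ∈ x /\ b ∈ y /\ p = opair a b.
Proof.
  unfold prd. rewrite sepP by definable. split; [tauto |].
  intros (a & b & Ha & Hb & ->). split; [|eauto 6].
  apply powP. intros z Hz. apply powP. intros t Ht. apply bunP.
  unfold opair, sing in Hz. apply upairP in Hz as [-> | ->];
    apply upairP in Ht as [-> | ->]; auto.
Qed.

Lemma opair_prd (x y a b : M) : opair a b ∈ prd x y <-> a ∈ x /\ b ∈ y.
Proof.
  rewrite prdP. split; [|intros [Ha Hb]; eauto 6].
  intros (a' & b' & Ha & Hb & [-> ->] %opair_inj). auto.
Qed.

Lemma tm_prd (u v : env -> M) : tm u -> tm v -> tm (fun rho => prd (u rho) (v rho)).
Proof. apply tm_op2. unfold prd. definable. Qed.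

Lemma is_prodE (p x y : M) : is_prod E p x y <-> p = prd x y.
Proof.
  assert (H : forall u, (exists a b, a ∈ x /\ b ∈ y /\ is_opair E u a b) <-> u ∈ prd x y).
  { intros u. rewrite prdP. split; intros (a & b & Ha & Hb & Hu); exists a, b;
      apply is_opairE in Hu || rewrite is_opairE; auto. }
  split; [|intros -> z; symmetry; apply H].
  intros G. apply set_ext. intros z. rewrite (G z). apply H.
Qed.

Ltac def_op ::= first [ def_op_pair | simple apply tm_prd ].

(** * Relations and functions as sets *)

Definition graph (x y : M) (R : M -> M -> Prop) : M :=
  sep (prd x y) (fun p => exists a b, p = opair a b /\ R a b).

Lemma graphP (x y : M) (R : M -> M -> Prop) (a b : M) :
  pdef (fun rho => R (rho 0) (rho 1)) ->
  opair a b ∈ graph x y R <-> a ∈ x /\ b ∈ y /\ R a b.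
Proof.
  intros HR. unfold graph. rewrite sepP.
  - rewrite opair_prd. split.
    + intros ((Ha & Hb) & a' & b' & [-> ->] %opair_inj & H). auto.
    + intros (Ha & Hb & H). eauto 6.
  - definable.
Qed.

Lemma appE (f x y : M) : app E f x y <-> opair x y ∈ f.
Proof.
  unfold app. split.
  - intros (p & -> %is_opairE & H). exact H.
  - intros H. exists (opair x y). rewrite is_opairE. auto.
Qed.

Lemma app_graph (x y : M) (R : M -> M -> Prop) (a b : M) :
  pdef (fun rho => R (rho 0) (rho 1)) ->
  app E (graph x y R) a b <-> a ∈ x /\ b ∈ y /\ R a b.
Proof. rewrite appE. apply graphP. Qed.

Lemma fun_on_graph (x y : M) (R : M -> M -> Prop) :
  pdef (fun rho => R (rho 0) (rho 1)) ->
  (forall a, a ∈ x -> exists! b, b ∈ y /\ R a b) -> fun_on E (graph x y R) x.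
Proof.
  intros HR H. split.
  - intros p Hp. assert (Hp' : p ∈ prd x y).
    { revert Hp. apply sepP. definable. }
    apply prdP in Hp' as (a & b & Ha & Hb & ->). exists a, b. rewrite is_opairE. auto.
  - intros a Ha. destruct (H a Ha) as (b & [Hb Hab] & Hu). exists b. split.
    + apply app_graph; auto.
    + intros b' (_ & ? & ?) %app_graph; auto.
Qed.

Lemma tm_graph (u v : env -> M) (R : env -> M -> M -> Prop) :
  tm u -> tm v -> pdef (fun rho => R (shift (shift rho)) (rho 0) (rho 1)) ->
  tm (fun rho => graph (u rho) (v rho) (R rho)).
Proof.
  intros Hu Hv HR. apply tm_sep; [apply tm_prd; assumption |].
  apply (@pdef_ex (fun a rho => exists b, rho 0 = opair a b /\ R (shift rho) a b)).
  apply (@pdef_ex (fun b rho => rho 1 = opair (rho 0) b /\ R (shift (shift rho)) (rho 0) b)).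
  apply pdef_and; [definable |].
  exact (pdef_substitute
    (fun n => inl (match n with 0 => 1 | 1 => 0 | _ => S n end)) HR).
Qed.

(** If y is the only value of f at x, the separated set is {y} and its union is y. This gives a
    total application built from definable set operations; components of pairs in f lie in ⋃⋃f. *)
Definition val (f x : M) : M := un (sep (un (un f)) (fun y => opair x y ∈ f)).

Lemma val_eq (f x y : M) :
  app E f x y -> (forall z, app E f x z -> z = y) -> val f x = y.
Proof.
  intros H Hu. rewrite appE in H. apply set_ext. intros t. unfold val. rewrite unP. split.
  - intros (z & Hz & Ht). rewrite sepP in Hz by definable.
    rewrite (Hu z) in Ht by (apply appE; tauto). exact Ht.
  - intros Ht. exists y. split; [|exact Ht]. rewrite sepP by definable. split; [|exact H].
    apply unP. exists (upair x y). split; [|apply upairP; auto].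
    apply unP. exists (opair x y). split; [exact H | apply upairP; auto].
Qed.

Lemma app_val (f a x y : M) : fun_on E f a -> app E f x y <-> x ∈ a /\ y = val f x.
Proof.
  intros [Hf Hu].
  assert (Hdom : forall y, app E f x y -> x ∈ a).
  { intros y' Hy. apply appE in Hy as Hy'. destruct (Hf _ Hy') as (x' & y'' & Hx & Hp).
    apply is_opairE, opair_inj in Hp as [-> _]. exact Hx. }
  split.
  - intros H. split; [eauto |]. symmetry. apply val_eq; [exact H |].
    intros z Hz. destruct (Hu x (Hdom _ H)) as (b & _ & Hb).
    rewrite <- (Hb _ H), (Hb _ Hz). reflexivity.
  - intros [Hx ->]. destruct (Hu x Hx) as (b & Hb & Hbu).
    rewrite (val_eq (y := b)); [exact Hb | exact Hb |]. intros z Hz. symmetry. auto.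
Qed.

Lemma tm_val (u v : env -> M) : tm u -> tm v -> tm (fun rho => val (u rho) (v rho)).
Proof. apply tm_op2. unfold val. definable. Qed.

Ltac def_op_set := first
  [ def_op_pair | simple apply tm_prd | simple apply tm_graph | simple apply tm_val ].
Ltac def_op ::= def_op_set.

Definition om : M := the (is_omega E).

Lemma inductiveE (w : M) :
  inductive E w <-> emp ∈ w /\ forall x, x ∈ w -> suc x ∈ w.
Proof.
  unfold inductive. split.
  - intros ((e & He & Hw) & H). apply is_emptyE in He as ->. split; [exact Hw |].
    intros x Hx. destruct (H x Hx) as (s & Hs & Hsw). apply is_succE in Hs as ->. exact Hsw.
  - intros [H0 HS]. split; [exists emp; rewrite is_emptyE; auto |].
    intros x Hx. exists (suc x). rewrite is_succE. auto.
Qed.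

Lemma pdef_inductive (u : env -> M) : tm u -> pdef (fun rho => inductive E (u rho)).
Proof.
  apply pdef_subst1. eapply pdef_ext; [intros; symmetry; apply inductiveE |]. definable.
Qed.

Ltac def_rel ::= simple apply pdef_inductive.

Lemma is_omegaE (w : M) : is_omega E w <-> w = om.
Proof.
  assert (H : is_omega E om).
  { unfold om. apply (theP (P := is_omega E)). destruct (zf_infinity HZF) as (w0 & Hw).
    exists (sep w0 (fun n => is_nat E n)). intros n. rewrite sepP.
    - split; [tauto | auto].
    - unfold is_nat. definable. }
  split; [|intros ->; exact H]. intros G. apply set_ext. intros n. rewrite (G n), (H n). tauto.
Qed.

Lemma is_natE (n : M) : is_nat E n <-> n ∈ om.
Proof. symmetry. apply (proj2 (is_omegaE om) eq_refl). Qed.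

Lemma emp_om : emp ∈ om.
Proof. apply (proj1 (is_natE _)). intros w Hw. apply inductiveE in Hw. tauto. Qed.

Lemma suc_om (n : M) : n ∈ om -> suc n ∈ om.
Proof.
  intros H%is_natE. apply (proj1 (is_natE _)). intros w Hw. pose proof (H w Hw) as Hn.
  apply inductiveE in Hw.
  destruct Hw as [_ Hw]. auto.
Qed.

(** A definable P cuts out an inductive subset of ω. The model may have nonstandard natural numbers,
    so induction over other predicates can fail. *)
Lemma om_ind (P : M -> Prop) : pdef (fun rho => P (rho 0)) ->
  P emp -> (forall n, n ∈ om -> P n -> P (suc n)) -> forall n, n ∈ om -> P n.
Proof.
  intros HP H0 HS n Hn.
  apply (sepP om HP). apply is_natE in Hn. apply Hn, inductiveE. split.
  - apply sepP; auto using emp_om.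
  - intros x Hx. rewrite sepP in * by assumption. destruct Hx. auto using suc_om.
Qed.

(** * Natural numbers *)

Lemma pdef_subset (u v : env -> M) : tm u -> tm v -> pdef (fun rho => subset E (u rho) (v rho)).
Proof. apply pdef_subst2. unfold subset. definable. Qed.

Ltac def_rel ::= first [ simple apply pdef_inductive | simple apply pdef_subset ].

Lemma mem_om (n m : M) : n ∈ om -> m ∈ n -> m ∈ om.
Proof.
  intros Hn. revert m. pattern n. revert n Hn. apply om_ind; [definable | |].
  - intros m Hm. case (empP Hm).
  - intros n Hn IH m [Hm | ->]%sucP; auto.
Qed.

Lemma mem_trans_om (n m k : M) : n ∈ om -> m ∈ n -> k ∈ m -> k ∈ n.
Proof.
  intros Hn. revert m k. pattern n. revert n Hn. apply om_ind; [definable | |].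
  - intros m k Hm. case (empP Hm).
  - intros n Hn IH m k [Hm | ->]%sucP Hk; apply sucP; eauto.
Qed.

Lemma mem_irrefl_om (n : M) : n ∈ om -> n ∉ n.
Proof.
  revert n. apply om_ind; [definable | apply empP |].
  intros n Hn IH [H | H]%sucP; apply IH.
  - apply (mem_trans_om (m := suc n)); auto. apply sucP; auto.
  - rewrite <- H at 2. apply sucP; auto.
Qed.

Lemma suc_mem_suc (n m : M) : n ∈ om -> m ∈ n -> suc m ∈ suc n.
Proof.
  intros Hn. revert m. pattern n. revert n Hn. apply om_ind; [definable | |].
  - intros m Hm. case (empP Hm).
  - intros n Hn IH m [Hm | ->]%sucP; apply sucP; auto.
Qed.

Lemma emp_mem_suc (n : M) : n ∈ om -> emp ∈ suc n.
Proof.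
  revert n. apply om_ind; [definable | apply sucP; auto |].
  intros n Hn IH. apply sucP; auto.
Qed.

Lemma om_trichotomy (n m : M) : n ∈ om -> m ∈ om -> m ∈ n \/ m = n \/ n ∈ m.
Proof.
  intros Hn. revert m. pattern n. revert n Hn. apply om_ind; [definable | |].
  - intros m Hm. pattern m. revert m Hm. apply om_ind; [definable | auto |].
    auto using emp_mem_suc.
  - intros n Hn IH m Hm. rewrite (sucP n m). destruct (IH m Hm) as [H | [H | H]]; auto.
    apply (suc_mem_suc Hm) in H. apply sucP in H as [H | H]; auto.
Qed.

Lemma suc_inj (n m : M) : n ∈ om -> suc n = suc m -> n = m.
Proof.
  intros Hn H.
  assert (H1 : n ∈ suc m) by (rewrite <- H; apply sucP; auto).
  assert (H2 : m ∈ suc n) by (rewrite H; apply sucP; auto).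
  apply sucP in H1 as [H1 |]; [|auto]. apply sucP in H2 as [H2 |]; [|auto].
  case (mem_irrefl_om Hn). exact (mem_trans_om Hn H2 H1).
Qed.

Lemma suc_neq_emp (n : M) : suc n <> emp.
Proof. intros H. apply (empP (z := n)). rewrite <- H. apply sucP; auto. Qed.

Lemma om_least (P : M -> Prop) : pdef (fun rho => P (rho 0)) ->
  forall n, n ∈ om -> P n -> exists m, m ∈ om /\ P m /\ forall k, k ∈ m -> ~ P k.
Proof.
  intros HP n Hn Pn. apply NNPP. intros Hno.
  assert (H : forall n, n ∈ om -> forall k, k ∈ n -> ~ P k).
  { apply (om_ind (P := fun n => forall k, k ∈ n -> ~ P k)); [definable | |].
    - intros k Hk. case (empP Hk).
    - intros m Hm IH k [Hk | ->]%sucP; [auto |]. intros Pm. apply Hno. eauto. }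
  apply (H (suc n)) with n; auto using suc_om. apply sucP; auto.
Qed.

(* The sequence s, g(s), g(g(s)), … in S, obtained as the least relation closed under the
   recursion. *)
Definition rec (S g s : M) : M :=
  sep (prd om S) (fun p => forall R, opair emp s ∈ R ->
    (forall i j, opair i j ∈ R -> opair (suc i) (val g j) ∈ R) -> p ∈ R).

Lemma tm_rec (u v w : env -> M) :
  tm u -> tm v -> tm w -> tm (fun rho => rec (u rho) (v rho) (w rho)).
Proof.
  intros Hu Hv Hw.
  apply (pdef_subst (Q := fun c rho => rho 0 = rec (u (shift rho)) (v (shift rho)) c)
           (tm_shift Hw)).
  apply (pdef_subst (Q := fun b rho => rho 1 = rec (u (shift (shift rho))) b (rho 0))
           (tm_shift (tm_shift Hv))).
  apply (pdef_subst (Q := fun a rho => rho 2 = rec a (rho 0) (rho 1))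
           (tm_shift (tm_shift (tm_shift Hu)))).
  unfold rec. definable.
Qed.

Section Recursion.

Variables S g s : M.
Hypothesis Hs : s ∈ S.
Hypothesis Hg : forall j, j ∈ S -> val g j ∈ S.

Lemma recP (p : M) : p ∈ rec S g s <-> p ∈ prd om S /\ forall R, opair emp s ∈ R ->
  (forall i j, opair i j ∈ R -> opair (suc i) (val g j) ∈ R) -> p ∈ R.
Proof. apply sepP. definable. Qed.

Lemma rec_emp_mem : opair emp s ∈ rec S g s.
Proof. apply recP. rewrite opair_prd. auto using emp_om. Qed.

Lemma rec_suc_mem (i j : M) :
  opair i j ∈ rec S g s -> opair (suc i) (val g j) ∈ rec S g s.
Proof.
  rewrite !recP, !opair_prd. intros [[Hi Hj] H]. split; auto using suc_om.
Qed.

(** A pair that is neither the start nor a successor pair could be deleted, leaving a relation still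
    closed under the recursion; but [rec] lies in every such relation. *)
Lemma rec_minimal (a b : M) : opair a b ∈ rec S g s ->
  (a = emp /\ b = s) \/ exists i j, opair i j ∈ rec S g s /\ a = suc i /\ b = val g j.
Proof.
  intros H. apply NNPP. intros Hno.
  assert (HP : pdef (fun rho => rho 0 <> opair a b)) by definable.
  assert (G : opair a b ∈ sep (rec S g s) (fun p => p <> opair a b)).
  { apply recP in H. apply H.
    - apply (sepP _ (P := fun p => p <> opair a b) HP). split; [apply rec_emp_mem |].
      intros [H1 H2]%opair_inj. auto.
    - intros i j Hij. rewrite sepP in * by exact HP. split; [apply rec_suc_mem; tauto |].
      intros [H1 H2]%opair_inj. apply Hno. right. exists i, j. destruct Hij. auto. }
  rewrite sepP in G by exact HP. tauto.
Qed.

Lemma rec_fun_on : fun_on E (rec S g s) om.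
Proof.
  split.
  - intros p Hp. apply recP in Hp as [(i & j & Hi & _ & ->)%prdP _].
    exists i, j. rewrite is_opairE. auto.
  - intros i Hi. cut (exists j, opair i j ∈ rec S g s /\
      forall j', opair i j' ∈ rec S g s -> j = j').
    { intros (j & Hj & Hu). exists j. split; [apply appE; exact Hj |].
      intros j' Hj'%appE. auto. }
    revert i Hi. apply om_ind; [definable | |].
    + exists s. split; [apply rec_emp_mem |].
      intros j [[_ ->] | (i & j' & _ & H & _)]%rec_minimal; [reflexivity |].
      symmetry in H. case (suc_neq_emp H).
    + intros n Hn (j & Hj & Hu). exists (val g j). split; [apply rec_suc_mem, Hj |].
      intros j' [[H _] | (i & j'' & Hi & H & ->)]%rec_minimal; [case (suc_neq_emp H) |].
      apply suc_inj in H as <-; auto. f_equal. auto.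
Qed.

Lemma val_rec_emp : val (rec S g s) emp = s.
Proof.
  symmetry. apply (app_val _ _ rec_fun_on). apply appE, rec_emp_mem.
Qed.

Lemma val_rec_suc (n : M) : n ∈ om -> val (rec S g s) (suc n) = val g (val (rec S g s) n).
Proof.
  intros Hn. symmetry. apply (app_val _ _ rec_fun_on). apply appE, rec_suc_mem.
  apply appE, (app_val _ _ rec_fun_on). auto.
Qed.

Lemma val_rec_mem (n : M) : n ∈ om -> val (rec S g s) n ∈ S.
Proof.
  intros Hn. assert (H : app E (rec S g s) n (val (rec S g s) n)).
  { apply (app_val _ _ rec_fun_on). auto. }
  apply appE in H. apply recP in H as [[_ H]%opair_prd _]. exact H.
Qed.

End Recursion.

Lemma val_graph (x y : M) (F : M -> M) (a : M) : tm (fun rho => F (rho 0)) ->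
  a ∈ x -> F a ∈ y -> val (graph x y (fun a b => b = F a)) a = F a.
Proof.
  intros HF Ha HFa.
  assert (HR : pdef (fun rho => rho 1 = F (rho 0))).
  { exact (pdef_substitute (fun n => inl (match n with 0 => 1 | _ => 0 end)) HF). }
  apply val_eq.
  - apply (app_graph x y (R := fun a b => b = F a)); auto.
  - intros z Hz. apply (app_graph x y (R := fun a b => b = F a)) in Hz; tauto.
Qed.

(** * Arithmetic of the model *)

Definition add (m n : M) : M := val (rec om (graph om om (fun a b => b = suc a)) m) n.
Definition mul (m n : M) : M := val (rec om (graph om om (fun a b => b = add a m)) emp) n.

Ltac def_op ::= first [ def_op_set | simple apply tm_rec ].

Lemma tm_add (u v : env -> M) : tm u -> tm v -> tm (fun rho => add (u rho) (v rho)).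
Proof. apply tm_op2. unfold add. definable. Qed.

Ltac def_op ::= first [ def_op_set | simple apply tm_rec | simple apply tm_add ].

Lemma tm_mul (u v : env -> M) : tm u -> tm v -> tm (fun rho => mul (u rho) (v rho)).
Proof. apply tm_op2. unfold mul. definable. Qed.

Ltac def_op_nat := first
  [ def_op_set | simple apply tm_rec | simple apply tm_add | simple apply tm_mul ].
Ltac def_op ::= def_op_nat.

Lemma val_suc_graph (a : M) : a ∈ om -> val (graph om om (fun a b => b = suc a)) a = suc a.
Proof. intros Ha. apply (val_graph (F := suc)); [definable | auto using suc_om ..]. Qed.

Lemma val_suc_graph_mem (a : M) : a ∈ om -> val (graph om om (fun a b => b = suc a)) a ∈ om.
Proof. intros Ha. rewrite val_suc_graph by auto. apply suc_om, Ha. Qed.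

Lemma add_om (m n : M) : m ∈ om -> n ∈ om -> add m n ∈ om.
Proof. intros Hm Hn. apply val_rec_mem; auto using val_suc_graph_mem. Qed.

Lemma add_emp (m : M) : m ∈ om -> add m emp = m.
Proof. intros Hm. apply val_rec_emp; auto using val_suc_graph_mem. Qed.

Lemma add_suc (m n : M) : m ∈ om -> n ∈ om -> add m (suc n) = suc (add m n).
Proof.
  intros Hm Hn. unfold add at 1. rewrite val_rec_suc; auto using val_suc_graph_mem.
  apply val_suc_graph, add_om; assumption.
Qed.

Lemma val_add_graph (m a : M) : m ∈ om -> a ∈ om ->
  val (graph om om (fun a b => b = add a m)) a = add a m.
Proof.
  intros Hm Ha. apply (val_graph (F := fun a => add a m)); [definable | auto using add_om ..].
Qed.

Lemma val_add_graph_mem (m a : M) : m ∈ om -> a ∈ om ->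
  val (graph om om (fun a b => b = add a m)) a ∈ om.
Proof. intros Hm Ha. rewrite val_add_graph by auto. apply add_om; auto. Qed.

Lemma mul_om (m n : M) : m ∈ om -> n ∈ om -> mul m n ∈ om.
Proof. intros Hm Hn. apply val_rec_mem; auto using val_add_graph_mem, emp_om. Qed.

Lemma mul_emp (m : M) : m ∈ om -> mul m emp = emp.
Proof. intros Hm. apply val_rec_emp; auto using val_add_graph_mem, emp_om. Qed.

Lemma mul_suc (m n : M) : m ∈ om -> n ∈ om -> mul m (suc n) = add (mul m n) m.
Proof.
  intros Hm Hn. unfold mul at 1. rewrite val_rec_suc; auto using val_add_graph_mem, emp_om.
  apply val_add_graph, mul_om; assumption.
Qed.

(** Any function witnessing the relational definition agrees with [add] by induction; conversely the
    set built by [rec] is such a witness. *)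
Lemma nat_addE (m n k : M) : nat_add E m n k <-> m ∈ om /\ n ∈ om /\ k = add m n.
Proof.
  unfold nat_add. rewrite !is_natE. split.
  - intros (Hm & Hn & w & f & ->%is_omegaE & Hf & H0 & HS & Hk). do 2 (split; [assumption |]).
    cut (opair n (add m n) ∈ f).
    { intros H%appE. apply (app_val _ _ Hf) in H as [_ ->]. apply (app_val _ _ Hf) in Hk. tauto. }
    clear Hk. revert n Hn. apply om_ind; [definable | |].
    + rewrite add_emp by assumption. apply appE, H0. apply is_emptyE. reflexivity.
    + intros n Hn IH. rewrite add_suc by assumption. apply appE.
      apply (HS n _ (add m n)); rewrite ?is_succE, ?appE; auto.
  - intros (Hm & Hn & ->). do 2 (split; [assumption |]).
    pose proof (rec_fun_on Hm val_suc_graph_mem) as Hf.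
    eexists _, _. split; [apply is_omegaE; reflexivity |]. split; [exact Hf |]. split; [|split].
    + intros e ->%is_emptyE. apply appE, rec_emp_mem; assumption.
    + intros i i' j j' ->%is_succE ->%is_succE H. apply appE. apply appE in H as H'.
      apply (app_val _ _ Hf) in H as [Hi ->].
      rewrite <- (@val_suc_graph (val _ i)) by (apply val_rec_mem; auto using val_suc_graph_mem).
      apply rec_suc_mem; auto using val_suc_graph_mem.
    + apply (app_val _ _ Hf). auto.
Qed.

Lemma nat_mulE (m n k : M) : nat_mul E m n k <-> m ∈ om /\ n ∈ om /\ k = mul m n.
Proof.
  unfold nat_mul. rewrite !is_natE. split.
  - intros (Hm & Hn & w & f & ->%is_omegaE & Hf & H0 & HS & Hk). do 2 (split; [assumption |]).
    cut (opair n (mul m n) ∈ f).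
    { intros H%appE. apply (app_val _ _ Hf) in H as [_ ->]. apply (app_val _ _ Hf) in Hk. tauto. }
    clear Hk. revert n Hn. apply om_ind; [definable | |].
    + rewrite mul_emp by assumption. apply appE, H0. apply is_emptyE. reflexivity.
    + intros n Hn IH. rewrite mul_suc by assumption. apply appE.
      apply (HS n _ (mul m n)); rewrite ?is_succE, ?appE, ?nat_addE; auto using mul_om.
  - intros (Hm & Hn & ->). do 2 (split; [assumption |]).
    assert (Hg : forall a, a ∈ om -> val (graph om om (fun a b => b = add a m)) a ∈ om).
    { auto using val_add_graph_mem. }
    pose proof (rec_fun_on emp_om Hg) as Hf.
    eexists _, _. split; [apply is_omegaE; reflexivity |]. split; [exact Hf |]. split; [|split].
    + intros e ->%is_emptyE. apply appE, rec_emp_mem; auto using emp_om.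
    + intros i i' j j' ->%is_succE (Hj & _ & ->)%nat_addE H. apply appE. apply appE in H.
      rewrite <- val_add_graph by assumption. apply rec_suc_mem; auto using emp_om.
    + apply (app_val _ _ Hf). auto.
Qed.
Lemma emp_add (n : M) : n ∈ om -> add emp n = n.
Proof.
  revert n. apply om_ind; [definable | apply add_emp, emp_om |].
  intros n Hn IH. rewrite add_suc, IH; auto using emp_om.
Qed.

Lemma suc_add (m n : M) : m ∈ om -> n ∈ om -> add (suc m) n = suc (add m n).
Proof.
  intros Hm. revert n. apply om_ind; [definable | |].
  - rewrite !add_emp; auto using suc_om.
  - intros n Hn IH. rewrite !add_suc, IH; auto using suc_om.
Qed.

Lemma add_comm (m n : M) : m ∈ om -> n ∈ om -> add m n = add n m.
Proof.
  intros Hm. revert n. apply om_ind; [definable | |].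
  - rewrite add_emp, emp_add; auto.
  - intros n Hn IH. rewrite add_suc, suc_add, IH; auto.
Qed.

Lemma add_assoc (m n k : M) : m ∈ om -> n ∈ om -> k ∈ om -> add m (add n k) = add (add m n) k.
Proof.
  intros Hm Hn. revert k. apply om_ind; [definable | |].
  - rewrite !add_emp; auto using add_om.
  - intros k Hk IH. rewrite !add_suc, IH; auto using add_om.
Qed.

Lemma emp_mul (n : M) : n ∈ om -> mul emp n = emp.
Proof.
  revert n. apply om_ind; [definable | apply mul_emp, emp_om |].
  intros n Hn IH. rewrite mul_suc, IH, add_emp; auto using emp_om.
Qed.

Lemma suc_mul (m n : M) : m ∈ om -> n ∈ om -> mul (suc m) n = add (mul m n) n.
Proof.
  intros Hm. revert n. apply om_ind; [definable | |].
  - rewrite !mul_emp, add_emp; auto using suc_om, emp_om.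
  - intros n Hn IH. rewrite !mul_suc, IH, !add_suc by auto using suc_om, mul_om, add_om.
    f_equal. rewrite <- !add_assoc by auto using mul_om. f_equal. apply add_comm; auto.
Qed.

Lemma mul_comm (m n : M) : m ∈ om -> n ∈ om -> mul m n = mul n m.
Proof.
  intros Hm. revert n. apply om_ind; [definable | |].
  - rewrite mul_emp, emp_mul; auto.
  - intros n Hn IH. rewrite mul_suc, suc_mul, IH; auto.
Qed.

Lemma mul_add_r (k m n : M) : k ∈ om -> m ∈ om -> n ∈ om ->
  mul k (add m n) = add (mul k m) (mul k n).
Proof.
  intros Hk Hm. revert n. apply om_ind; [definable | |].
  - rewrite add_emp, mul_emp, add_emp; auto using mul_om.
  - intros n Hn IH. rewrite add_suc, !mul_suc, IH, add_assoc; auto using mul_om, add_om.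
Qed.

Lemma mul_assoc (m n k : M) : m ∈ om -> n ∈ om -> k ∈ om -> mul m (mul n k) = mul (mul m n) k.
Proof.
  intros Hm Hn. revert k. apply om_ind; [definable | |].
  - rewrite !mul_emp; auto using mul_om.
  - intros k Hk IH. rewrite !mul_suc, mul_add_r, IH; auto using mul_om.
Qed.

(** An ambient type for the natural numbers of the model: on it the operations satisfy the semiring
    laws outright, so that [ring] can prove the identities between cross-multiplied fractions. *)
Definition N : Type := {n : M | n ∈ om}.
Definition nat_val (a : N) : M := proj1_sig a.
Coercion nat_val : N >-> M.

Lemma N_om (a : N) : a ∈ om.
Proof. exact (proj2_sig a). Qed.

Lemma N_eq (a b : N) : (a : M) = b -> a = b.
Proof. apply eq_sig_hprop. intros. apply proof_irrelevance. Qed.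

Definition N0 : N := exist _ emp emp_om.
Definition N1 : N := exist _ (suc emp) (suc_om emp_om).
Definition Nadd (a b : N) : N := exist _ (add a b) (add_om (N_om a) (N_om b)).
Definition Nmul (a b : N) : N := exist _ (mul a b) (mul_om (N_om a) (N_om b)).

Local Infix "+" := Nadd.
Local Infix "*" := Nmul.
Local Notation "a < b" := (E (nat_val a) (nat_val b)).
Local Notation "a ≤ b" := (~ E (nat_val b) (nat_val a)) (at level 70).

Lemma N_semiring : semi_ring_theory N0 N1 Nadd Nmul eq.
Proof.
  split; intros; apply N_eq; simpl; auto using emp_add, add_comm, add_assoc, emp_mul,
    mul_comm, mul_assoc, N_om.
  - rewrite suc_mul, emp_mul, emp_add; auto using N_om, emp_om.
  - rewrite mul_comm, mul_add_r by auto using N_om, add_om.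
    rewrite (mul_comm (n := n)), (mul_comm (m := p)); auto using N_om.
Qed.

Add Ring N_ring : N_semiring.

Lemma N_lt_total (a b : N) : a < b \/ a = b \/ b < a.
Proof.
  destruct (om_trichotomy (N_om b) (N_om a)) as [H | [H | H]]; auto using N_eq.
Qed.

Lemma N_lt_irrefl (a : N) : ~ a < a.
Proof. apply mem_irrefl_om, N_om. Qed.

Lemma N_lt_trans (a b c : N) : a < b -> b < c -> a < c.
Proof. intros H G. exact (mem_trans_om (N_om c) G H). Qed.

Lemma N_add_lt (a b c : N) : a < b -> a + c < b + c.
Proof.
  simpl. generalize (N_om a), (N_om b), (N_om c).
  generalize (a : M), (b : M), (c : M). intros x y z Hx Hy Hz H.
  pattern z. revert z Hz. apply om_ind; [definable | |].
  - rewrite !add_emp; auto.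
  - intros n Hn IH. rewrite !add_suc; auto using suc_mem_suc, add_om.
Qed.

Lemma N_add_lt_inv (a b c : N) : a + c < b + c -> a < b.
Proof.
  intros H. destruct (N_lt_total a b) as [G | [<- | G]]; [exact G | |].
  - case (N_lt_irrefl H).
  - case (@N_lt_irrefl (a + c)). apply (N_lt_trans H), N_add_lt, G.
Qed.

Lemma N_add_lt_le (a b c d : N) : a < b -> c ≤ d -> a + c < b + d.
Proof.
  intros H G. apply (N_add_lt c) in H.
  destruct (N_lt_total c d) as [K | [<- | K]]; [| exact H | contradiction].
  apply (N_lt_trans H). apply (N_add_lt b) in K.
  replace (b + c) with (c + b) by ring. replace (b + d) with (d + b) by ring. exact K.
Qed.

Lemma N_lt_le (a b : N) : a < b -> a ≤ b.
Proof. intros H G. exact (N_lt_irrefl (N_lt_trans H G)). Qed.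

(* a < b follows from a' < b' when a - b = a' - b'. *)
Lemma N_lt_shift (a' b' a b : N) : a' < b' -> a + b' = b + a' -> a < b.
Proof.
  intros H G. apply N_add_lt_inv with b'. rewrite G.
  replace (b + a') with (a' + b) by ring. replace (b + b') with (b' + b) by ring.
  apply N_add_lt, H.
Qed.

Lemma N_mul_lt (a b c : N) : N0 < c -> a < b -> a * c < b * c.
Proof.
  intros Hc H. destruct c as [c' Hc']. simpl in *. revert Hc.
  pattern c'. revert c' Hc'. apply om_ind; [definable | intros G; case (empP G) |].
  intros n Hn IH _. rewrite !mul_suc by auto using N_om.
  (* The induction hypothesis speaks of positive factors only, so the factor 1 is treated
     separately. *)
  destruct (classic (n = emp)) as [-> | Hne].
  - rewrite !mul_emp, !emp_add by auto using N_om. exact H.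
  - assert (G : emp ∈ n).
    { destruct (om_trichotomy Hn emp_om) as [G | [G | G]]; [exact G | congruence |].
      case (empP G). }
    apply IH in G. apply (@N_add_lt_le (exist _ _ (mul_om (N_om a) Hn))
      (exist _ _ (mul_om (N_om b) Hn)) a b G). apply N_lt_le, H.
Qed.

Lemma N_mul_lt_inv (a b c : N) : a * c < b * c -> a < b.
Proof.
  intros H. destruct (N_lt_total a b) as [G | [<- | G]]; [exact G | |].
  - case (N_lt_irrefl H).
  - destruct (N_lt_total N0 c) as [Hc | [<- | Hc]].
    + case (N_lt_irrefl (N_lt_trans H (N_mul_lt Hc G))).
    + replace (a * N0) with (b * N0) in H by ring. case (N_lt_irrefl H).
    + case (empP Hc).
Qed.

Lemma N_mul_le (a b c : N) : a ≤ b -> a * c ≤ b * c.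
Proof. intros H G. apply N_mul_lt_inv in G. contradiction. Qed.

Lemma N_lt_succ (a : N) : a < a + N1.
Proof.
  apply N_lt_shift with N0 N1; [|ring]. simpl. apply emp_mem_suc, emp_om.
Qed.

Lemma N_lt_iff_succ_le (a b : N) : a < b <-> a + N1 ≤ b.
Proof.
  split.
  - intros H G. simpl in G. rewrite add_suc, add_emp in G by auto using N_om, emp_om.
    apply sucP in G as [G | G].
    + case (N_lt_irrefl (N_lt_trans H G)).
    + rewrite G in H. case (mem_irrefl_om (N_om a) H).
  - intros H. destruct (N_lt_total a b) as [G | [-> | G]]; [exact G | |].
    + case H. apply N_lt_succ.
    + case H. exact (N_lt_trans G (N_lt_succ a)).
Qed.

Lemma N_pos (c : N) : N0 < c <-> (c : M) <> emp.
Proof.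
  split.
  - intros H G. rewrite G in H. case (empP H).
  - intros H. destruct (N_lt_total N0 c) as [G | [<- | G]]; [exact G | case H; reflexivity |].
    case (empP G).
Qed.

Lemma N_mul_pos (a b : N) : N0 < a -> N0 < b -> N0 < a * b.
Proof.
  intros Ha Hb. apply (N_mul_lt Hb) in Ha. replace (N0 * b) with N0 in Ha by ring. exact Ha.
Qed.

Lemma N_add_pos (a b : N) : N0 < a -> N0 < a + b.
Proof.
  intros Ha. replace N0 with (N0 + N0) by ring. apply N_add_lt_le; [exact Ha |]. apply empP.
Qed.

(** * Fractions *)

Opaque add mul.

Definition fr (a b c : M) : M := opair (opair a b) c.

Lemma fr_inj (a b c a' b' c' : N) : fr a b c = fr a' b' c' -> a = a' /\ b = b' /\ c = c'.
Proof. intros [[H1 H2]%opair_inj H3]%opair_inj. auto using N_eq. Qed.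

Lemma fracE (q a b c : M) : frac E q a b c <->
  a ∈ om /\ b ∈ om /\ c ∈ om /\ c <> emp /\ q = fr a b c.
Proof.
  unfold frac. rewrite !is_natE, inhabitedE. split.
  - intros (Ha & Hb & Hc & Hc0 & u & ->%is_opairE & ->%is_opairE). auto.
  - intros (Ha & Hb & Hc & Hc0 & ->). do 4 (split; [assumption |]).
    exists (opair a b). rewrite !is_opairE. auto.
Qed.

Lemma frac_fr (a b c : N) : N0 < c -> frac E (fr a b c) a b c.
Proof. rewrite fracE, N_pos. auto using N_om. Qed.

Lemma frac_N (q a b c : M) : frac E q a b c ->
  exists a' b' c' : N, N0 < c' /\ a = a' /\ b = b' /\ c = c' /\ q = fr a' b' c'.
Proof.
  intros (Ha & Hb & Hc & Hc0 & ->)%fracE.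
  exists (exist _ a Ha), (exist _ b Hb), (exist _ c Hc). rewrite N_pos. auto.
Qed.

Lemma is_frac_N (q : M) : is_frac E q -> exists a b c : N, N0 < c /\ q = fr a b c.
Proof.
  intros (a & b & c & (a' & b' & c' & Hc & _ & _ & _ & Hq)%frac_N). eauto.
Qed.

Lemma is_frac_fr (a b c : N) : N0 < c -> is_frac E (fr a b c).
Proof. intros H. eexists _, _, _. apply frac_fr, H. Qed.

Lemma frac_lt_is_frac (p q : M) : frac_lt E p q -> is_frac E p /\ is_frac E q.
Proof.
  intros (a & b & c & a' & b' & c' & Hp & Hq & _). split; eexists _, _, _; eassumption.
Qed.

Lemma frac_ltE (a b c a' b' c' : N) : N0 < c -> N0 < c' ->
  frac_lt E (fr a b c) (fr a' b' c') <-> a * c' + b' * c < a' * c + b * c'.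
Proof.
  intros Hc Hc'. unfold frac_lt. split.
  - intros (? & ? & ? & ? & ? & ? & (a1 & b1 & c1 & _ & -> & -> & -> & Hq)%frac_N
      & (a2 & b2 & c2 & _ & -> & -> & -> & Hq')%frac_N & H).
    apply fr_inj in Hq as (-> & -> & ->), Hq' as (-> & -> & ->).
    destruct H as (? & ? & ? & ? & ? & ? & (_ & _ & ->)%nat_mulE & (_ & _ & ->)%nat_mulE
      & (_ & _ & ->)%nat_mulE & (_ & _ & ->)%nat_mulE & (_ & _ & ->)%nat_addE
      & (_ & _ & ->)%nat_addE & H). exact H.
  - intros H. exists a, b, c, a', b', c'. do 2 (split; [apply frac_fr; assumption |]).
    exists (a * c'), (b * c'), (a' * c), (b' * c), (a * c' + b' * c), (a' * c + b * c').
    rewrite !nat_mulE, !nat_addE. auto 20 using N_om.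
Qed.

Lemma frac_addE (a b c a' b' c' : N) (r : M) : N0 < c -> N0 < c' ->
  frac_add E (fr a b c) (fr a' b' c') r <->
  r = fr (a * c' + a' * c) (b * c' + b' * c) (c * c').
Proof.
  intros Hc Hc'. unfold frac_add. split.
  - intros (? & ? & ? & ? & ? & ? & (a1 & b1 & c1 & _ & -> & -> & -> & Hq)%frac_N
      & (a2 & b2 & c2 & _ & -> & -> & -> & Hq')%frac_N & H).
    apply fr_inj in Hq as (-> & -> & ->), Hq' as (-> & -> & ->).
    destruct H as (? & ? & ? & ? & ? & ? & ? & (_ & _ & ->)%nat_mulE & (_ & _ & ->)%nat_mulE
      & (_ & _ & ->)%nat_mulE & (_ & _ & ->)%nat_mulE & (_ & _ & ->)%nat_addE
      & (_ & _ & ->)%nat_addE & (_ & _ & ->)%nat_mulE & H). apply fracE in H. apply H.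
  - intros ->. exists a, b, c, a', b', c'. do 2 (split; [apply frac_fr; assumption |]).
    exists (a * c'), (b * c'), (a' * c), (b' * c), (a * c' + a' * c), (b * c' + b' * c), (c * c').
    rewrite !nat_mulE, !nat_addE. do 7 (split; [auto using N_om |]).
    apply frac_fr, N_mul_pos; assumption.
Qed.

Lemma frac_lt_asym (p q : M) : frac_lt E p q -> ~ frac_lt E q p.
Proof.
  intros H G. apply frac_lt_is_frac in H as H'. destruct H' as [Hp Hq].
  apply is_frac_N in Hp as (a & b & c & Hc & ->), Hq as (a' & b' & c' & Hc' & ->).
  rewrite frac_ltE in H, G by assumption. apply (@N_lt_irrefl (a * c' + b' * c)).
  apply (N_lt_trans H), (N_lt_shift G). ring.
Qed.

(** Different fractions may denote the same rational number, so [frac_lt] is not total; this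
    property takes the place of trichotomy. *)
Lemma frac_lt_cotrans (p p' q : M) :
  frac_lt E p p' -> is_frac E q -> frac_lt E p q \/ frac_lt E q p'.
Proof.
  intros H Hq. apply frac_lt_is_frac in H as H'. destruct H' as [Hp Hp'].
  apply is_frac_N in Hp as (a & b & c & Hc & ->), Hp' as (a' & b' & c' & Hc' & ->),
    Hq as (x & y & z & Hz & ->).
  apply NNPP. intros G. apply not_or_and in G as [G G']. apply G'.
  rewrite frac_ltE in H, G |- * by assumption.
  (* With q ≤ p assumed, p < p' scaled by z and q ≤ p scaled by c' add up to the goal scaled by
     c. *)
  apply N_mul_lt_inv with c.
  apply N_lt_shift with ((a * c' + b' * c) * z + (x * c + b * z) * c')
    ((a' * c + b * c') * z + (a * z + y * c) * c'); [|ring].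
  apply N_add_lt_le; [apply N_mul_lt; assumption | apply N_mul_le, G].
Qed.

Lemma frac_lt_trans (p q r : M) : frac_lt E p q -> frac_lt E q r -> frac_lt E p r.
Proof.
  intros H G. destruct (frac_lt_cotrans H (proj2 (frac_lt_is_frac G))) as [K | K];
    [exact K | case (frac_lt_asym G K)].
Qed.

Lemma frac_lt_dense (p q : M) : frac_lt E p q -> exists m, frac_lt E p m /\ frac_lt E m q.
Proof.
  intros H. apply frac_lt_is_frac in H as H'. destruct H' as [Hp Hq].
  apply is_frac_N in Hp as (a & b & c & Hc & ->), Hq as (a' & b' & c' & Hc' & ->).
  pose proof (N_add_pos c' Hc) as Hcc. rewrite frac_ltE in H by assumption.
  (* the mediant *)
  exists (fr (a + a') (b + b') (c + c')). rewrite !frac_ltE by assumption.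
  split; apply (N_lt_shift H); ring.
Qed.

Lemma frac_unbounded_below (q : M) : is_frac E q -> exists p, frac_lt E p q.
Proof.
  intros (a & b & c & Hc & ->)%is_frac_N. exists (fr a (b + N1) c). rewrite frac_ltE by assumption.
  apply (N_lt_shift Hc). ring.
Qed.

Definition frac_zero : M := fr emp emp (suc emp).
Definition frac_inv (n : M) : M := fr (suc emp) emp n.

Lemma tm_frac_inv (u : env -> M) : tm u -> tm (fun rho => frac_inv (u rho)).
Proof. unfold frac_inv, fr. intros. definable. Qed.

Lemma N1_pos : N0 < N1.
Proof. apply emp_mem_suc, emp_om. Qed.

Lemma is_frac_zero : is_frac E frac_zero.
Proof. apply (is_frac_fr N0 N0 N1_pos). Qed.

Lemma is_frac_inv (n : M) : n ∈ om -> n <> emp -> is_frac E (frac_inv n).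
Proof. intros Hn Hn0. apply (is_frac_fr N1 N0 (c := exist _ n Hn)), N_pos, Hn0. Qed.

Lemma frac_lt_zero (a b c : N) : N0 < c -> frac_lt E (fr a b c) frac_zero <-> a < b.
Proof.
  intros Hc. change frac_zero with (fr N0 N0 N1).
  rewrite frac_ltE by (assumption || apply N1_pos).
  split; intros H; apply (N_lt_shift H); ring.
Qed.

Lemma frac_zero_lt (a b c : N) : N0 < c -> frac_lt E frac_zero (fr a b c) <-> b < a.
Proof.
  intros Hc. change frac_zero with (fr N0 N0 N1).
  rewrite frac_ltE by (assumption || apply N1_pos).
  split; intros H; apply (N_lt_shift H); ring.
Qed.

Lemma frac_inv_pos (n : M) : n ∈ om -> n <> emp -> frac_lt E frac_zero (frac_inv n).
Proof.
  intros Hn Hn0. apply (frac_zero_lt N1 N0 (c := exist _ n Hn)); [apply N_pos, Hn0 | apply N1_pos].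
Qed.

Lemma frac_inv_lt (m n : M) : m ∈ om -> n ∈ om -> m <> emp -> n <> emp ->
  frac_lt E (frac_inv m) (frac_inv n) <-> n ∈ m.
Proof.
  intros Hm Hn Hm0 Hn0.
  set (m' := exist _ m Hm : N). set (n' := exist _ n Hn : N).
  change (frac_lt E (fr N1 N0 m') (fr N1 N0 n') <-> n' < m').
  rewrite frac_ltE by (apply N_pos; assumption).
  split; intros H; apply (N_lt_shift H); ring.
Qed.

Lemma frac_archimedean (q : M) : frac_lt E frac_zero q ->
  exists n, n ∈ om /\ n <> emp /\ frac_lt E (frac_inv n) q.
Proof.
  intros H. destruct (is_frac_N (proj2 (frac_lt_is_frac H))) as (a & b & c & Hc & ->).
  apply frac_zero_lt in H; [|assumption].
  assert (Hc1 : N0 < c + N1) by (apply N_add_pos, Hc).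
  (* A positive fraction with denominator c is at least 1/c, hence greater than 1/(c + 1). *)
  exists (c + N1). split; [apply N_om |]. split; [apply N_pos, Hc1 |].
  apply (frac_ltE N1 N0 a b Hc1 Hc).
  apply N_lt_iff_succ_le, (N_mul_le (c := c + N1)) in H.
  pose proof (N_add_lt_le (N_lt_succ c) H) as G. apply (N_lt_shift G). ring.
Qed.

(** With negated [frac_lt] read as ≤: x ≤ q and y < 1/n give x + y ≤ q'. The number n depends on q
    and q' alone, a uniformity that [dst_triangle] inherits. *)
Lemma frac_add_small (q q' : M) : frac_lt E q q' ->
  exists n, n ∈ om /\ n <> emp /\ forall x y z, is_frac E x -> ~ frac_lt E q x ->
    frac_lt E y (frac_inv n) -> frac_add E x y z -> ~ frac_lt E q' z.
Proof.
  intros H. apply frac_lt_is_frac in H as H'. destruct H' as [Hq Hq'].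
  apply is_frac_N in Hq as (a3 & b3 & c3 & Hc3 & ->), Hq' as (a4 & b4 & c4 & Hc4 & ->).
  rewrite frac_ltE in H by assumption. pose proof (N_mul_pos Hc3 Hc4) as Hn.
  (* q + 1/(c3 c4) ≤ q' *)
  exists (c3 * c4). split; [apply N_om |]. split; [apply N_pos, Hn |].
  intros x y z Hx Hqx Hy Hz G. apply frac_lt_is_frac in Hy as H'. destruct H' as [Hy' _].
  apply is_frac_N in Hx as (a1 & b1 & c1 & Hc1 & ->), Hy' as (a2 & b2 & c2 & Hc2 & ->).
  pose proof (N_mul_pos Hc1 Hc2) as Hc12.
  apply frac_addE in Hz; try assumption. subst z.
  apply (frac_ltE a2 b2 N1 N0 Hc2 Hn) in Hy.
  rewrite frac_ltE in Hqx, G by assumption.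
  (* The four inequalities are scaled to a common denominator; their sum is absurd once equal terms
     cancel. *)
  apply (N_mul_le (c := c2 * c4)) in Hqx.
  apply (N_mul_lt Hc1) in Hy. apply N_lt_iff_succ_le, (N_mul_le (c := c1 * c2)) in H.
  apply (N_mul_lt Hc3) in G.
  pose proof (N_add_lt_le (N_add_lt_le Hy Hqx) H) as K.
  apply (N_lt_irrefl (a := N0)).
  pose proof (N_add_lt_le K (N_lt_le G)) as L. apply (N_lt_shift L). ring.
Qed.

Lemma frac_add_is_frac (p q r : M) :
  frac_add E p q r -> is_frac E p /\ is_frac E q /\ is_frac E r.
Proof.
  intros (a & b & c & a' & b' & c' & Hp & Hq & H).
  destruct H as (? & ? & ? & ? & s & t & d & _ & _ & _ & _ & _ & _ & _ & Hr).
  split; [|split]; eexists _, _, _; eassumption.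
Qed.

Lemma frac_add_le (x y z q q' w : M) : is_frac E q -> is_frac E q' ->
  ~ frac_lt E q x -> ~ frac_lt E q' y -> frac_add E x y z -> frac_add E q q' w -> ~ frac_lt E w z.
Proof.
  intros Hq Hq' Hqx Hqy Hz Hw G.
  destruct (frac_add_is_frac Hz) as (Hx & Hy & _).
  apply is_frac_N in Hx as (a1 & b1 & c1 & Hc1 & ->), Hy as (a2 & b2 & c2 & Hc2 & ->),
    Hq as (a3 & b3 & c3 & Hc3 & ->), Hq' as (a4 & b4 & c4 & Hc4 & ->).
  apply frac_addE in Hz, Hw; try assumption. subst z w.
  rewrite frac_ltE in Hqx by assumption. rewrite frac_ltE in Hqy by assumption.
  apply frac_ltE in G; [|apply N_mul_pos; assumption ..].
  apply (N_mul_le (c := c2 * c4)) in Hqx. apply (N_mul_le (c := c1 * c3)) in Hqy.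
  pose proof (N_add_lt_le (N_add_lt_le G Hqx) Hqy) as K.
  apply (N_lt_irrefl (a := N0)), (N_lt_shift K). ring.
Qed.

Lemma frac_add_exists (p q : M) :
  is_frac E p -> is_frac E q -> exists r, is_frac E r /\ frac_add E p q r.
Proof.
  intros (a & b & c & Hc & ->)%is_frac_N (a' & b' & c' & Hc' & ->)%is_frac_N.
  eexists. split; [|apply frac_addE; [assumption .. | reflexivity]].
  apply (is_frac_fr _ _ (N_mul_pos Hc Hc')).
Qed.

Lemma frac_add_comm (p q r : M) : frac_add E p q r -> frac_add E q p r.
Proof.
  intros H. destruct (frac_add_is_frac H) as (Hp & Hq & _).
  apply is_frac_N in Hp as (a & b & c & Hc & ->), Hq as (a' & b' & c' & Hc' & ->).
  apply frac_addE in H; [|assumption ..]. subst r. apply frac_addE; [assumption .. |].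
  replace (c' * c) with (c * c') by ring. replace (b' * c + b * c') with (b * c' + b' * c) by ring.
  replace (a' * c + a * c') with (a * c' + a' * c) by ring. reflexivity.
Qed.

(** Both strict steps are spent: the second makes y negative, the first puts q below q2 + y, whose
    value is that of q1. *)
Lemma frac_add_neg (q q1 q2 : M) : frac_lt E q q1 -> frac_lt E q1 q2 ->
  exists y z, frac_lt E y frac_zero /\ frac_add E q2 y z /\ frac_lt E q z.
Proof.
  intros H G. apply frac_lt_is_frac in H as H'. destruct H' as [Hq Hq1].
  pose proof (proj2 (frac_lt_is_frac G)) as Hq2.
  apply is_frac_N in Hq as (a & b & c & Hc & ->), Hq1 as (a1 & b1 & c1 & Hc1 & ->),
    Hq2 as (a2 & b2 & c2 & Hc2 & ->).
  pose proof (N_mul_pos Hc1 Hc2) as Hc12. pose proof (N_mul_pos Hc2 Hc12) as Hc212.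
  (* y = q1 - q2 *)
  exists (fr (a1 * c2 + b2 * c1) (b1 * c2 + a2 * c1) (c1 * c2)). eexists.
  split; [|split; [apply frac_addE; [assumption .. | reflexivity] |]].
  - apply frac_lt_zero; [assumption |]. apply frac_ltE in G; [|assumption ..].
    apply (N_lt_shift G). ring.
  - apply frac_ltE in H; [|assumption ..]. apply frac_ltE; [assumption .. |].
    apply (N_mul_lt (N_mul_pos Hc2 Hc2)) in H. apply (N_lt_shift H). ring.
Qed.
(** * Finite sets *)

Lemma pdef_app (u v w : env -> M) :
  tm u -> tm v -> tm w -> pdef (fun rho => app E (u rho) (v rho) (w rho)).
Proof.
  apply pdef_subst3. eapply pdef_ext; [intros; symmetry; apply appE |]. definable.
Qed.

Lemma pdef_fun_on (u v : env -> M) : tm u -> tm v -> pdef (fun rho => fun_on E (u rho) (v rho)).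
Proof.
  apply pdef_subst2.
  apply pdef_ext with (fun rho =>
    (forall p, p ∈ rho 0 -> exists x y, x ∈ rho 1 /\ p = opair x y) /\
    (forall x, x ∈ rho 1 -> exists! y, opair x y ∈ rho 0)); [|definable].
  intros rho. symmetry. unfold fun_on.
  split; intros [H G]; (split; [intros p Hp; destruct (H p Hp) as (x & y & Hx & Hy) |
    intros x Hx; destruct (G x Hx) as (y & Hy & Hu)]).
  - apply is_opairE in Hy. eauto.
  - exists y. apply appE in Hy. split; [exact Hy | intros z Hz; apply Hu, appE, Hz].
  - exists x, y. rewrite is_opairE. auto.
  - exists y. split; [apply appE, Hy | intros z Hz; apply Hu, appE, Hz].
Qed.

Ltac def_rel_fun := first [ simple apply pdef_inductive | simple apply pdef_subset
  | simple apply pdef_app | simple apply pdef_fun_on ].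
Ltac def_rel ::= def_rel_fun.

Lemma finiteE (x : M) : finite E x <-> exists n f, n ∈ om /\ fun_on E f n /\ injective E f /\
  forall y, y ∈ x <-> exists i, app E f i y.
Proof.
  unfold finite.
  split; intros (n & f & Hn & H); exists n, f; (split; [| exact H]);
    revert Hn; rewrite is_natE; auto.
Qed.

Lemma pdef_finite (u : env -> M) : tm u -> pdef (fun rho => finite E (u rho)).
Proof.
  apply pdef_subst1. eapply pdef_ext; [intros; symmetry; apply finiteE |].
  unfold injective. definable.
Qed.

Ltac def_rel ::= first [ def_rel_fun | simple apply pdef_finite ].

Lemma finite_emp : finite E emp.
Proof.
  apply finiteE. exists emp, emp. split; [apply emp_om |]. repeat split.
  - intros p Hp. case (empP Hp).
  - intros p Hp. case (empP Hp).
  - intros x x' y Hx%appE. case (empP Hx).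
  - intros Hy. case (empP Hy).
  - intros (i & Hi%appE). case (empP Hi).
Qed.

Lemma app_add (f n a i y : M) :
  app E (bun f (sing (opair n a))) i y <-> app E f i y \/ (i = n /\ y = a).
Proof.
  rewrite !appE, bunP, singP. split; intros [H | H]; auto.
  - apply opair_inj in H. auto.
  - destruct H as [-> ->]. auto.
Qed.

Lemma fun_on_add (f n a : M) :
  n ∈ om -> fun_on E f n -> fun_on E (bun f (sing (opair n a))) (suc n).
Proof.
  intros Hn Hf. split.
  - intros p [Hp | ->%singP]%bunP.
    + destruct (proj1 Hf p Hp) as (x & y & Hx & Hxy). exists x, y. rewrite sucP. auto.
    + exists n, a. rewrite sucP, is_opairE. auto.
  - intros x [Hx | ->]%sucP.
    + destruct (proj2 Hf x Hx) as (y & Hy & Hu). exists y. split; [apply app_add; auto |].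
      intros y' [H | [-> _]]%app_add; [auto |]. case (mem_irrefl_om Hn Hx).
    + exists a. split; [apply app_add; auto |].
      intros y' [[H _]%(app_val _ _ Hf) | [_ ->]]%app_add; [|reflexivity].
      case (mem_irrefl_om Hn H).
Qed.

Lemma finite_add (F a : M) : finite E F -> finite E (bun F (sing a)).
Proof.
  intros HF. destruct (classic (a ∈ F)) as [Ha | Ha].
  { replace (bun F (sing a)) with F; [exact HF |]. apply set_ext. intros z.
    rewrite bunP, singP. split; [auto | intros [H | ->]; auto]. }
  apply finiteE in HF as (n & f & Hn & Hf & Hinj & HF). apply finiteE.
  exists (suc n), (bun f (sing (opair n a))). split; [apply suc_om, Hn |].
  split; [apply fun_on_add; assumption | split].
  - intros x x' y [H | [-> ->]]%app_add [H' | [-> Hy]]%app_add.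
    + eauto.
    + subst. case Ha. apply HF. eauto.
    + case Ha. apply HF. eauto.
    + reflexivity.
  - intros y. rewrite bunP, singP, HF. split.
    + intros [[i Hi] | ->]; [exists i | exists n]; apply app_add; auto.
    + intros [i [H | [_ ->]]%app_add]; eauto.
Qed.

(** Induction on the length of an enumeration, for all sets and enumerations of that length at once:
    dropping the last value leaves a shorter enumeration of the remaining set. *)
Lemma finite_ind (P : M -> Prop) : pdef (fun rho => P (rho 0)) ->
  P emp -> (forall F a, P F -> P (bun F (sing a))) -> forall F, finite E F -> P F.
Proof.
  intros HP H0 HS F (n & f & Hn & H)%finiteE. revert f F H. pattern n. revert n Hn.
  apply om_ind; [unfold injective; definable | |].
  - intros f F (Hf & _ & HF). replace F with emp; [exact H0 |]. apply set_ext. intros z.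
    rewrite HF. split; [intros H; case (empP H) |].
    intros [i Hi]. apply (app_val _ _ Hf) in Hi as [Hi _]. case (empP Hi).
  - intros n Hn IH f F (Hf & Hinj & HF).
    assert (Hlast : app E f n (val f n)).
    { apply (app_val _ _ Hf). rewrite sucP. auto. }
    set (F' := sep F (fun y => exists i, i ∈ n /\ opair i y ∈ f)).
    set (f' := sep f (fun p => exists i y, i ∈ n /\ p = opair i y)).
    assert (Hf' : forall i y, app E f' i y <-> i ∈ n /\ app E f i y).
    { intros i y. unfold f'. rewrite !appE, sepP by definable. split.
      - intros (H & i' & y' & Hi & [-> ->]%opair_inj). auto.
      - intros [Hi H]. eauto 6. }
    assert (HF' : forall y, y ∈ F' <-> exists i, app E f' i y).
    { intros y. unfold F'. rewrite sepP by definable. split.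
      - intros (_ & i & Hi & H%appE). exists i. apply Hf'. auto.
      - intros (i & [Hi H]%Hf'). split; [apply HF; eauto |]. exists i. rewrite <- appE. auto. }
    replace F with (bun F' (sing (val f n))).
    + apply HS. apply (IH f'). split; [|split; [|exact HF']].
      * split.
        -- intros p Hp. unfold f' in Hp. rewrite sepP in Hp by definable.
           destruct Hp as (_ & i & y & Hi & ->). exists i, y. rewrite is_opairE. auto.
        -- intros i Hi. destruct (proj2 Hf i) as (y & Hy & Hu); [apply sucP; auto |].
           exists y. split; [apply Hf'; auto |]. intros z [_ Hz]%Hf'. auto.
      * intros x x' y [_ H]%Hf' [_ H']%Hf'. eauto.
    + apply set_ext. intros z. rewrite bunP, singP, HF'. split.
      * intros [(i & [_ Hi]%Hf') | ->]; apply HF; eauto.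
      * intros [i Hi]%HF. apply (app_val _ _ Hf) in Hi as Hi'. destruct Hi' as [[H | ->]%sucP Hz].
        -- left. exists i. apply Hf'. auto.
        -- auto.
Qed.

(** [R] may be partial and [G] is merely contained in the image, so subsets of finite sets are
    covered as well. *)
Lemma finite_image (R : M -> M -> Prop) (F : M) : pdef (fun rho => R (rho 0) (rho 1)) ->
  (forall a b b', R a b -> R a b' -> b = b') -> finite E F ->
  forall G, (forall b, b ∈ G -> exists a, a ∈ F /\ R a b) -> finite E G.
Proof.
  intros HR Hfun. revert F.
  apply (finite_ind (P := fun F => forall G, (forall b, b ∈ G -> exists a, a ∈ F /\ R a b) ->
    finite E G)); [definable | |].
  - intros G HG. replace G with emp; [apply finite_emp |]. apply set_ext. intros z.
    split; [intros H; case (empP H) |]. intros (a & Ha & _)%HG. case (empP Ha).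
  - intros F a IH G HG.
    assert (HP : pdef (fun rho => exists a, a ∈ F /\ R a (rho 0))) by definable.
    set (G' := sep G (fun b => exists a, a ∈ F /\ R a b)).
    assert (HG' : finite E G').
    { apply IH. intros b Hb. apply (sepP G HP) in Hb. apply Hb. }
    destruct (classic (exists b, b ∈ G /\ R a b)) as [(b & Hb & Hab) | Hno].
    + replace G with (bun G' (sing b)); [apply finite_add, HG' |].
      apply set_ext. intros z. unfold G'. rewrite bunP, singP, (sepP G HP). split.
      * intros [[H _] | ->]; assumption.
      * intros Hz. destruct (HG z Hz) as (a' & [Ha' | ->%singP]%bunP & H); eauto.
    + replace G with G'; [exact HG' |].
      apply set_ext. intros z. unfold G'. rewrite (sepP G HP). split; [tauto |].
      intros Hz. split; [exact Hz |].
      destruct (HG z Hz) as (a' & [Ha' | ->%singP]%bunP & H); [eauto |]. case Hno. eauto.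
Qed.

Lemma finite_bun (F G : M) : finite E F -> finite E G -> finite E (bun F G).
Proof.
  intros HF HG. revert F HF. apply finite_ind; [definable | |].
  - replace (bun emp G) with G; [exact HG |]. apply set_ext. intros z. rewrite bunP.
    split; [auto | intros [H | H]; [case (empP H) | exact H]].
  - intros F a IH. replace (bun (bun F (sing a)) G) with (bun (bun F G) (sing a)).
    + apply finite_add, IH.
    + apply set_ext. intros z. rewrite !bunP. tauto.
Qed.

Lemma pdef_covers (u v : env -> M) : tm u -> tm v -> pdef (fun rho => covers E (u rho) (v rho)).
Proof. apply pdef_subst2. unfold covers. definable. Qed.

Ltac def_rel_fin := first [ def_rel_fun | simple apply pdef_finite | simple apply pdef_covers ].
Ltac def_rel ::= def_rel_fin.

(** One member of the cover is picked per point; induction makes these finitely many picks without a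
    choice principle. *)
Lemma finite_subcover (C F : M) : finite E F -> covers E C F ->
  exists G, subset E G C /\ finite E G /\ covers E G F.
Proof.
  revert F. apply (finite_ind (P := fun F => covers E C F ->
    exists G, subset E G C /\ finite E G /\ covers E G F)); [definable | |].
  - intros _. exists emp. split; [|split; [apply finite_emp |]];
      intros z Hz; case (empP Hz).
  - intros F a IH H. destruct IH as (G & HG & HGf & HGF).
    { intros x Hx. apply H, bunP. auto. }
    destruct (H a) as (U & HU & Ha). { apply bunP. rewrite singP. auto. }
    exists (bun G (sing U)). split; [|split; [apply finite_add, HGf |]].
    + intros z [Hz | ->%singP]%bunP; auto.
    + intros x [Hx | ->%singP]%bunP.
      * destruct (HGF x Hx) as (V & HV & HxV). exists V. rewrite bunP. auto.
      * exists U. rewrite bunP, singP. auto.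
Qed.

(** * Topological spaces *)

Section Topology.

Variables X T : M.
Hypothesis HT : topology E X T.

Lemma open_subset (U : M) : U ∈ T -> subset E U X.
Proof. apply HT. Qed.

Lemma open_full : X ∈ T.
Proof. apply HT. Qed.

Lemma open_inter (U V : M) : U ∈ T -> V ∈ T -> sep U (fun z => z ∈ V) ∈ T.
Proof.
  intros HU HV. apply (proj1 (proj2 (proj2 (proj2 HT))) U V); try assumption.
  intros z. rewrite sepP by definable. tauto.
Qed.

(** A is the union of all open sets contained in it; taking all of them avoids choosing a
    neighbourhood for each point. *)
Lemma open_local (A : M) : (forall x, x ∈ A -> exists U, U ∈ T /\ x ∈ U /\ subset E U A) -> A ∈ T.
Proof.
  intros H. apply (proj2 (proj2 (proj2 (proj2 HT))) (sep T (fun U => subset E U A))).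
  - intros z Hz. rewrite sepP in Hz by definable. tauto.
  - intros z. split.
    + intros (U & HU & Hz & HA)%H. exists U. rewrite sepP by definable. auto.
    + intros (U & HU & Hz). rewrite sepP in HU by definable. apply HU, Hz.
Qed.

Lemma closed_local (A : M) : closed E X T A <-> subset E A X /\
  forall x, x ∈ X -> x ∉ A -> exists U, U ∈ T /\ x ∈ U /\ forall z, z ∈ U -> z ∉ A.
Proof.
  unfold closed. split; intros [HA H]; (split; [exact HA |]).
  - assert (HD : forall z, z ∈ sep X (fun z => z ∉ A) <-> z ∈ X /\ z ∉ A).
    { intros z. apply sepP. definable. }
    intros x Hx HxA. exists (sep X (fun z => z ∉ A)).
    split; [apply H; exact HD |]. split; [apply HD; auto |]. intros z Hz%HD. tauto.
  - intros U HU. apply open_local. intros x [Hx HxA]%HU.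
    destruct (H x Hx HxA) as (V & HV & HxV & HVA). exists V. split; [exact HV |].
    split; [exact HxV |]. intros z Hz. apply HU. split; [exact (open_subset HV Hz) | auto].
Qed.

(** The cover consists of all open sets that can be separated from x, so separating neighbourhoods
    are picked only after compactness has left finitely many sets. *)
Lemma compact_closed (K : M) : hausdorff E X T -> compact E X T K -> closed E X T K.
Proof.
  intros HH [HK Hcomp]. apply closed_local. split; [exact HK |]. intros x Hx HxK.
  set (C := sep T (fun V => exists U, U ∈ T /\ x ∈ U /\ forall z, z ∈ U -> z ∉ V)).
  assert (HC : forall V, V ∈ C <-> V ∈ T /\ exists U, U ∈ T /\ x ∈ U /\ forall z, z ∈ U -> z ∉ V).
  { intros V. apply sepP. definable. }
  destruct (Hcomp C) as (F & HF & HFf & HFK).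
  - intros V HV. apply HC in HV. tauto.
  - intros y Hy. destruct (HH x y) as (U & V & HU & HV & HxU & HyV & Hdis); auto.
    { intros ->. contradiction. }
    exists V. split; [|exact HyV]. apply HC. split; [exact HV |]. exists U. firstorder.
  - assert (H : exists U, U ∈ T /\ x ∈ U /\ forall z, z ∈ U -> forall V, V ∈ F -> z ∉ V).
    { clear HFK. revert F HFf HF. apply (finite_ind (P := fun F => subset E F C ->
        exists U, U ∈ T /\ x ∈ U /\ forall z, z ∈ U -> forall V, V ∈ F -> z ∉ V));
        [definable | |].
      - intros _. exists X. split; [apply open_full |]. split; [exact Hx |].
        intros z _ V HV. case (empP HV).
      - intros F a IH HF. destruct IH as (U & HU & HxU & HUF).
        { intros z Hz. apply HF, bunP. auto. }
        destruct (proj1 (HC a)) as (Ha & U' & HU' & HxU' & HUa).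
        { apply HF, bunP. rewrite singP. auto. }
        exists (sep U (fun z => z ∈ U')). split; [apply open_inter; assumption |].
        rewrite sepP by definable. split; [auto |].
        intros z Hz V [HV | ->%singP]%bunP; rewrite sepP in Hz by definable; destruct Hz.
        + apply HUF; assumption.
        + auto. }
    destruct H as (U & HU & HxU & HUF). exists U. do 2 (split; [assumption |]).
    intros z Hz HzK. destruct (HFK z HzK) as (V & HV & HzV). exact (HUF z Hz V HV HzV).
Qed.

(** In a Hausdorff space compact sets are closed, so a closed set always meets them in closed sets.
    Only the other half of the k-space condition has content. *)
Lemma k_space_intro : hausdorff E X T ->
  (forall A, subset E A X ->
    (forall K, compact E X T K -> closed E X T (sep A (fun z => z ∈ K))) -> closed E X T A) ->
  k_space E X T.
Proof.
  intros HH H. split; [exact HT |]. split; [exact HH |]. intros A HA. split.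
  - intros HcA K B HK HB. apply (compact_closed HH) in HK.
    apply closed_local in HcA as [_ HcA]. apply closed_local in HK as [_ HK].
    apply closed_local. split; [intros z [Hz _]%HB; auto |].
    intros x Hx HxB. destruct (classic (x ∈ A)) as [HxA | HxA].
    + destruct (HK x Hx) as (U & HU & HxU & HUK). { intros G. apply HxB, HB. auto. }
      exists U. do 2 (split; [assumption |]). intros z Hz [_ G]%HB. exact (HUK z Hz G).
    + destruct (HcA x Hx HxA) as (U & HU & HxU & HUA).
      exists U. do 2 (split; [assumption |]). intros z Hz [G _]%HB. exact (HUA z Hz G).
  - intros G. apply H; [exact HA |]. intros K HK. apply (G K); [exact HK |].
    intros z. rewrite sepP by definable. tauto.
Qed.

(* The sets U n are the intersections of the initial segments of a countable base at x. *)
Lemma decreasing_base (x : M) : first_countable E X T -> x ∈ X ->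
  exists U : M -> M, tm (fun rho => U (rho 0)) /\
    (forall n, n ∈ om -> U n ∈ T /\ x ∈ U n) /\
    (forall n m, n ∈ om -> m ∈ n -> subset E (U n) (U m)) /\
    forall W, W ∈ T -> x ∈ W -> exists n, n ∈ om /\ subset E (U n) W.
Proof.
  intros Hfc Hx. destruct (Hfc x Hx) as (B & (f & Hf & Hinj & Hnat) & HBT & HB).
  (* The injection f numbers the base, possibly with gaps; U n uses the members with number below n,
     so U 0 = X and a gap changes nothing. *)
  set (U := fun n => sep X (fun y => forall V m, app E f V m -> m ∈ n -> y ∈ V)).
  assert (HU : forall n y, y ∈ U n <-> y ∈ X /\ forall V m, app E f V m -> m ∈ n -> y ∈ V).
  { intros n y. apply sepP. definable. }
  assert (HUd : tm (fun rho => U (rho 0))) by (unfold U; definable).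
  assert (HfB : forall V m, app E f V m -> V ∈ B).
  { intros V m H. apply (app_val _ _ Hf) in H. tauto. }
  exists U. split; [exact HUd |]. split; [|split].
  - intros n Hn. split.
    2:{ apply HU. split; [exact Hx |]. intros V m H _. apply (HBT V), (HfB V m H). }
    revert n Hn. apply om_ind.
    { apply pdef_mem; [exact HUd | definable]. }
    + replace (U emp) with X; [apply open_full |]. apply set_ext. intros y. rewrite HU.
      split; [|tauto]. intros Hy. split; [exact Hy |]. intros V m _ Hm. case (empP Hm).
    + intros n Hn IH.
      assert (HS : forall y, y ∈ U (suc n) <->
        y ∈ U n /\ forall V, app E f V n -> y ∈ V).
      { intros y. rewrite !HU. split.
        - intros [Hy H]. split; [split; [exact Hy |] |]; intros; eapply H; eauto; apply sucP; auto.
        - intros [[Hy H] G]. split; [exact Hy |]. intros V m HV [Hm | ->]%sucP; eauto. }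
      destruct (classic (exists V, app E f V n)) as [[V HV] | Hno].
      * replace (U (suc n)) with (sep (U n) (fun y => y ∈ V)).
        { apply open_inter; [exact IH |]. apply (HBT V), (HfB V n HV). }
        apply set_ext. intros y. rewrite HS, sepP by definable.
        split; intros [Hy H]; (split; [exact Hy |]); [|auto].
        intros V' HV'. rewrite (Hinj V' V n); assumption.
      * replace (U (suc n)) with (U n); [exact IH |]. apply set_ext. intros y. rewrite HS.
        split; [|tauto]. intros Hy. split; [exact Hy |]. intros V HV. case Hno. eauto.
  - intros n m Hn Hm y [Hy H]%HU. apply HU. split; [exact Hy |].
    intros V k HV Hk. apply (H V k HV). exact (mem_trans_om Hn Hm Hk).
  - intros W HW HxW. destruct (HB W HW HxW) as (V & HV & HVW).
    assert (Happ : app E f V (val f V)) by (apply (app_val _ _ Hf); auto).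
    pose proof (Hnat _ _ Happ) as Hm. rewrite is_natE in Hm.
    (* The successor is needed because U n only involves numbers strictly below n. *)
    exists (suc (val f V)). split; [apply suc_om, Hm |]. intros y [_ Hy]%HU. apply HVW.
    apply (Hy V _ Happ), sucP. auto.
Qed.

Lemma CMC_k_space : CMC E -> hausdorff E X T -> first_countable E X T -> k_space E X T.
Proof.
  intros Hcmc HH Hfc. apply k_space_intro; [exact HH |]. intros A HA HAK.
  apply closed_local. split; [exact HA |]. intros x Hx HxA. apply NNPP. intros Hno.
  destruct (decreasing_base Hfc Hx) as (U & HUd & HU & HUdec & HUb).
  assert (HUAd : tm (fun rho => sep A (fun y => y ∈ U (rho 0)))).
  { definable. }
  assert (HUA : forall n y, n ∈ om -> y ∈ sep A (fun y => y ∈ U n) <-> y ∈ A /\ y ∈ U n).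
  { intros n y Hn. rewrite sepP by definable. tauto. }
  set (S := graph om (pow X) (fun n a => a = sep A (fun y => y ∈ U n))).
  assert (HSd : pdef (fun rho => rho 1 = sep A (fun y => y ∈ U (rho 0)))).
  { exact (pdef_eq (tm_var 1) HUAd). }
  assert (HS : forall n a, app E S n a <-> n ∈ om /\ a = sep A (fun y => y ∈ U n)).
  { intros n a. unfold S. rewrite app_graph by exact HSd. split; [tauto |].
    intros [Hn ->]. split; [exact Hn |]. split; [|reflexivity].
    apply powP. intros y Hy. apply (HUA n y Hn) in Hy. apply HA, Hy. }
  destruct (Hcmc om S) as (F & HF & HFS).
  - apply is_omegaE. reflexivity.
  - apply fun_on_graph; [exact HSd |]. intros n Hn. exists (sep A (fun y => y ∈ U n)).
    split; [|intros b [_ ->]; reflexivity]. split; [|reflexivity].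
    apply powP. intros y Hy. apply (HUA n y Hn) in Hy. apply HA, Hy.
  - intros n a [Hn ->]%HS. apply NNPP. intros Hemp. apply Hno. exists (U n).
    split; [apply HU, Hn |]. split; [apply HU, Hn |]. intros z Hz HzA. apply Hemp.
    exists z. apply HUA; auto.
  - assert (HFU : forall n b, app E F n b -> n ∈ om /\ inhabited E b /\ finite E b /\
      forall y, y ∈ b -> y ∈ A /\ y ∈ U n).
    { intros n b Hb. assert (Hn : n ∈ om) by (apply (app_val _ _ HF) in Hb; tauto).
      destruct (HFS n (sep A (fun y => y ∈ U n)) b) as (H1 & H2 & H3);
        [apply HS; auto | exact Hb |].
      do 3 (split; [assumption |]). intros y Hy. apply HUA; auto. }
    set (K := sep X (fun y => y = x \/ exists n b, app E F n b /\ y ∈ b)).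
    assert (HK : forall y, y ∈ K <-> y = x \/ exists n b, app E F n b /\ y ∈ b).
    { intros y. unfold K. rewrite sepP by definable. split; [tauto |]. intros H.
      split; [|exact H]. destruct H as [-> | (n & b & (_ & _ & _ & H)%HFU & Hy)]; [exact Hx |].
      apply HA, (H y Hy). }
    assert (HKc : compact E X T K).
    { split; [intros y Hy; unfold K in Hy; rewrite sepP in Hy by definable; tauto |].
      intros C HC HCK. destruct (HCK x) as (W & HW & HxW). { apply HK. auto. }
      destruct (HUb W (HC W HW) HxW) as (n & Hn & HnW).
      (* W contains U n, and by monotonicity every F i with i ≥ n. Only the finitely many earlier F
         i remain, and their subcovers are collected by induction on n. *)
      assert (HG : exists G, subset E G C /\ finite E G /\
        forall i b, i ∈ n -> app E F i b -> covers E G b).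
      { clear HnW. revert n Hn. apply om_ind; [definable | |].
        - exists emp. split; [intros z Hz; case (empP Hz) |]. split; [apply finite_emp |].
          intros i b Hi. case (empP Hi).
        - intros n Hn (G & HGC & HGf & HG).
          assert (Hb : app E F n (val F n)) by (apply (app_val _ _ HF); auto).
          destruct (HFU _ _ Hb) as (_ & _ & Hbf & _).
          destruct (finite_subcover Hbf (C := C)) as (G' & HGC' & HGf' & HG').
          { intros y Hy. apply HCK, HK. eauto. }
          exists (bun G G'). split; [intros z [Hz | Hz]%bunP; auto |].
          split; [apply finite_bun; assumption |]. intros i b [Hi | ->]%sucP Hib y Hy.
          + destruct (HG i b Hi Hib y Hy) as (V & HV & HyV). exists V. rewrite bunP. auto.
          + apply (app_val _ _ HF) in Hib as [_ ->].
            destruct (HG' y Hy) as (V & HV & HyV). exists V. rewrite bunP. auto. }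
      destruct HG as (G & HGC & HGf & HG). exists (bun G (sing W)).
      split; [intros z [Hz | ->%singP]%bunP; auto |].
      split; [apply finite_add, HGf |]. intros y Hy.
      cut (y ∈ W \/ exists V, V ∈ G /\ y ∈ V).
      { intros [H | (V & HV & H)]; [exists W | exists V]; rewrite bunP, singP; auto. }
      apply HK in Hy as [-> | (i & b & Hib & Hy)]; [auto |].
      destruct (HFU _ _ Hib) as (Hi & _ & _ & HbU). destruct (HbU y Hy) as [_ HyU].
      destruct (om_trichotomy Hi Hn) as [H | [-> | H]].
      - left. apply HnW, (HUdec i n Hi H), HyU.
      - left. apply HnW, HyU.
      - right. exact (HG i b H Hib y Hy). }
    apply HAK in HKc. apply closed_local in HKc as [_ HKc].
    (* As x is outside A, closedness of A ∩ K would give x a neighbourhood missing A ∩ K; but it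
       contains some U n, hence the non-empty F n. *)
    destruct (HKc x Hx) as (V & HV & HxV & HVA). { rewrite sepP by definable. tauto. }
    destruct (HUb V HV HxV) as (n & Hn & HnV).
    assert (Hb : app E F n (val F n)) by (apply (app_val _ _ HF); auto).
    destruct (HFU _ _ Hb) as (_ & [y Hy] & _ & HbU). destruct (HbU y Hy) as [HyA HyU].
    apply (HVA y); [apply HnV, HyU |]. rewrite sepP by definable. split; [exact HyA |].
    apply HK. eauto.
Qed.

End Topology.
(** * Real numbers and metrics *)

Lemma pdef_frac_lt (u v : env -> M) : tm u -> tm v -> pdef (fun rho => frac_lt E (u rho) (v rho)).
Proof.
  apply pdef_subst2.
  apply pdef_ext with (fun rho => exists a b c a' b' c', (c ∈ om /\ c <> emp) /\
    (c' ∈ om /\ c' <> emp) /\ a ∈ om /\ b ∈ om /\ a' ∈ om /\ b' ∈ om /\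
    rho 0 = opair (opair a b) c /\ rho 1 = opair (opair a' b') c' /\
    add (mul a c') (mul b' c) ∈ add (mul a' c) (mul b c')); [|definable].
  intros rho. split.
  - intros (a & b & c & a' & b' & c' & [Hc Hc0] & [Hc' Hc0'] & Ha & Hb & Ha' & Hb' & -> & -> & H).
    apply (frac_ltE (exist _ a Ha) (exist _ b Hb) (exist _ a' Ha') (exist _ b' Hb')
      (c := exist _ c Hc) (c' := exist _ c' Hc')); [apply N_pos; assumption .. | exact H].
  - intros H. destruct (frac_lt_is_frac H) as [Hp Hq].
    apply is_frac_N in Hp as (a & b & c & Hc & Hp), Hq as (a' & b' & c' & Hc' & Hq).
    rewrite Hp, Hq in *. apply frac_ltE in H; [|assumption ..].
    rewrite N_pos in Hc, Hc'. exists a, b, c, a', b', c'. auto 20 using N_om.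
Qed.

Lemma pdef_frac_add (u v w : env -> M) : tm u -> tm v -> tm w ->
  pdef (fun rho => frac_add E (u rho) (v rho) (w rho)).
Proof.
  apply pdef_subst3.
  apply pdef_ext with (fun rho => exists a b c a' b' c', (c ∈ om /\ c <> emp) /\
    (c' ∈ om /\ c' <> emp) /\ a ∈ om /\ b ∈ om /\ a' ∈ om /\ b' ∈ om /\
    rho 0 = opair (opair a b) c /\ rho 1 = opair (opair a' b') c' /\
    rho 2 = opair (opair (add (mul a c') (mul a' c)) (add (mul b c') (mul b' c))) (mul c c'));
    [|definable].
  intros rho. split.
  - intros (a & b & c & a' & b' & c' & [Hc Hc0] & [Hc' Hc0'] & Ha & Hb & Ha' & Hb' & -> & -> & ->).
    apply (frac_addE (exist _ a Ha) (exist _ b Hb) (exist _ a' Ha') (exist _ b' Hb')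
      (c := exist _ c Hc) (c' := exist _ c' Hc')); [apply N_pos; assumption .. | reflexivity].
  - intros H. assert (Hpq : is_frac E (rho 0) /\ is_frac E (rho 1)).
    { destruct H as (a & b & c & a' & b' & c' & Hp & Hq & _).
      split; eexists _, _, _; eassumption. }
    destruct Hpq as [(a & b & c & Hc & Hp)%is_frac_N (a' & b' & c' & Hc' & Hq)%is_frac_N].
    rewrite Hp, Hq in *. apply frac_addE in H; [|assumption ..].
    rewrite N_pos in Hc, Hc'. exists a, b, c, a', b', c'. auto 20 using N_om.
Qed.

(** Being a fraction is expressed as having some fraction below, which reuses the definability of
    [frac_lt]. *)
Lemma pdef_is_frac (u : env -> M) : tm u -> pdef (fun rho => is_frac E (u rho)).
Proof.
  apply pdef_subst1.
  apply pdef_ext with (fun rho => exists p, frac_lt E p (rho 0));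
    [|apply (pdef_ex (Q := fun p rho => frac_lt E p (rho 0))), pdef_frac_lt; definable].
  intros rho. split; [intros [p H]; apply (frac_lt_is_frac H) | apply frac_unbounded_below].
Qed.

Ltac def_rel ::= first [ def_rel_fin | simple apply pdef_is_frac | simple apply pdef_frac_lt
  | simple apply pdef_frac_add ].

Definition fracs : M := prd (prd om om) om.

Lemma is_frac_fracs (q : M) : is_frac E q -> q ∈ fracs.
Proof.
  intros (a & b & c & _ & ->)%is_frac_N. unfold fracs, fr. rewrite !opair_prd. auto using N_om.
Qed.

Lemma is_real_frac (r q : M) : is_real E r -> q ∈ r -> is_frac E q.
Proof. intros Hr. apply Hr. Qed.

Lemma is_real_below (r p q : M) : is_real E r -> q ∈ r -> frac_lt E p q -> p ∈ r.
Proof. intros (_ & _ & _ & H & _) Hq Hp. exact (H q p Hq Hp). Qed.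

Lemma is_real_no_max (r q : M) : is_real E r -> q ∈ r -> exists q', q' ∈ r /\ frac_lt E q q'.
Proof. intros (_ & _ & _ & _ & H). apply H. Qed.

(** Since r has no maximum, some p' in r exceeds p. Cotransitivity gives p < q or q < p', and the
    latter would put q into r. *)
Lemma is_real_lt_le (r p q : M) : is_real E r -> p ∈ r -> is_frac E q -> q ∉ r ->
  frac_lt E p q.
Proof.
  intros Hr Hp Hq Hqr. destruct (is_real_no_max Hr Hp) as (p' & Hp' & H).
  destruct (frac_lt_cotrans H Hq) as [G | G]; [exact G |].
  case Hqr. exact (is_real_below Hr Hp' G).
Qed.

Lemma real_lt_iff (r e : M) : is_real E r -> is_real E e ->
  real_lt E r e <-> exists q, q ∈ e /\ q ∉ r.
Proof.
  intros Hr He. split.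
  - intros [(_ & _ & Hre) Hne]. apply NNPP. intros H. apply Hne, set_ext. intros z.
    split; [apply Hre |]. intros Hz. apply NNPP. eauto.
  - intros (q & Hq & Hqr). split; [|intros ->; contradiction].
    do 2 (split; [assumption |]). intros p Hp. apply (is_real_below He Hq).
    exact (is_real_lt_le Hr Hp (is_real_frac He Hq) Hqr).
Qed.

(** The supremum of a non-empty set of fractions bounded by p1. Rational cuts, sums of cuts and the
    distances constructed below are all recognized as reals in this form. *)
Lemma is_real_sup (I : M -> Prop) (r p0 p1 : M) :
  I p0 -> (forall p, I p -> is_frac E p) -> is_frac E p1 -> (forall p, I p -> ~ frac_lt E p1 p) ->
  (forall q, q ∈ r <-> exists p, I p /\ frac_lt E q p) -> is_real E r.
Proof.
  intros H0 HI Hp1 H1 Hr. split; [|split; [|split; [|split]]].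
  - intros q (p & _ & H)%Hr. apply (frac_lt_is_frac H).
  - destruct (frac_unbounded_below (HI p0 H0)) as [q Hq]. exists q. apply Hr. eauto.
  - exists p1. split; [exact Hp1 |]. intros (p & Hp & H)%Hr. exact (H1 p Hp H).
  - intros q q' (p & Hp & H)%Hr Hq'. apply Hr. exists p. split; [exact Hp |].
    exact (frac_lt_trans Hq' H).
  - intros q (p & Hp & H)%Hr. destruct (frac_lt_dense H) as (m & Hm & Hmp).
    exists m. split; [apply Hr; eauto | exact Hm].
Qed.

Definition cut (p : M) : M := sep fracs (fun q => frac_lt E q p).

Lemma cutP (p q : M) : q ∈ cut p <-> frac_lt E q p.
Proof.
  unfold cut. rewrite sepP by definable. split; [tauto |]. intros H.
  split; [apply is_frac_fracs, (frac_lt_is_frac H) | exact H].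
Qed.

Lemma is_real_cut (p : M) : is_frac E p -> is_real E (cut p).
Proof.
  intros Hp. apply (is_real_sup (I := fun q => q = p) (p0 := p) (p1 := p)).
  - reflexivity.
  - intros q ->. exact Hp.
  - exact Hp.
  - intros q -> H. exact (frac_lt_asym H H).
  - intros q. rewrite cutP. split; [eauto | intros (p' & -> & H); exact H].
Qed.

Lemma real_zeroE (z : M) : real_zero E z <-> z = cut frac_zero.
Proof.
  assert (H : forall q, (exists a b c, frac E q a b c /\ a ∈ b) <-> q ∈ cut frac_zero).
  { intros q. rewrite cutP. split.
    - intros (? & ? & ? & (a & b & c & Hc & -> & -> & -> & ->)%frac_N & H).
      apply frac_lt_zero; assumption.
    - intros H. destruct (is_frac_N (proj1 (frac_lt_is_frac H))) as (a & b & c & Hc & ->).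
      exists a, b, c. split; [apply frac_fr, Hc | apply frac_lt_zero in H; assumption]. }
  unfold real_zero. split.
  - intros G. apply set_ext. intros q. rewrite (G q). apply H.
  - intros -> q. symmetry. apply H.
Qed.

Lemma frac_zero_notin_cut : frac_zero ∉ cut frac_zero.
Proof. rewrite cutP. intros H. exact (frac_lt_asym H H). Qed.

Lemma real_pos_archimedean (e q : M) : is_real E e -> q ∈ e -> q ∉ cut frac_zero ->
  exists n, n ∈ om /\ n <> emp /\ frac_inv n ∈ e.
Proof.
  intros He Hq Hq0. destruct (is_real_no_max He Hq) as (q' & Hq' & H).
  destruct (frac_lt_cotrans H is_frac_zero) as [G | G]; [case Hq0; apply cutP, G |].
  destruct (frac_archimedean G) as (n & Hn & Hn0 & Hnq). exists n. do 2 (split; [assumption |]).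
  exact (is_real_below He Hq' Hnq).
Qed.

Lemma frac_inv_notin_mono (r m n : M) : is_real E r -> m ∈ om -> n <> emp -> n ∈ m ->
  frac_inv m ∉ r -> frac_inv n ∉ r.
Proof.
  intros Hr Hm Hn0 Hnm H G. apply H, (is_real_below Hr G), frac_inv_lt; auto.
  - exact (mem_om Hm Hnm).
  - intros ->. case (empP Hnm).
Qed.

(** The triangle inequality in [metric] is conditional on a given sum u, so one has to be supplied
    before it can be applied. *)
Lemma real_add_exists (s t : M) : is_real E s -> is_real E t ->
  exists u, real_add E s t u /\ forall q, q ∈ u ->
    exists x y z, x ∈ s /\ y ∈ t /\ frac_add E x y z /\ frac_lt E q z.
Proof.
  intros Hs Ht.
  assert (H : forall q, q ∈ sep fracs (fun q => exists x y z, x ∈ s /\ y ∈ t /\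
      frac_add E x y z /\ frac_lt E q z) <->
      exists x y z, x ∈ s /\ y ∈ t /\ frac_add E x y z /\ frac_lt E q z).
  { intros q. rewrite sepP by definable. split; [tauto |]. intros G. split; [|exact G].
    destruct G as (_ & _ & z & _ & _ & _ & G). apply is_frac_fracs, (frac_lt_is_frac G). }
  eexists. split; [split; [exact Hs |]; split; [exact Ht | exact H] |]. intros q. apply H.
Qed.

Definition dst (d x y : M) : M := val d (opair x y).

Lemma tm_dst (u v w : env -> M) :
  tm u -> tm v -> tm w -> tm (fun rho => dst (u rho) (v rho) (w rho)).
Proof. unfold dst. intros. definable. Qed.

(* Quantifying over the closed balls of radius 1/n, since 1/n ∉ r means that r ≤ 1/n. *)
Definition metric_open (X d U : M) : Prop :=
  subset E U X /\ forall x, x ∈ U -> exists n, n ∈ om /\ n <> emp /\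
    forall y, y ∈ X -> frac_inv n ∉ dst d x y -> y ∈ U.

Ltac def_op ::= first [ def_op_nat | simple apply tm_frac_inv | simple apply tm_dst ].

Lemma pdef_metric_open (X d : M) (u : env -> M) :
  tm u -> pdef (fun rho => metric_open X d (u rho)).
Proof. apply pdef_subst1. unfold metric_open. definable. Qed.

Section Metric.

Variables X d : M.
Hypothesis Hd : metric E X d.

Lemma distE (x y r : M) : dist E d x y r <-> x ∈ X /\ y ∈ X /\ r = dst d x y.
Proof.
  destruct Hd as [(P & ->%is_prodE & Hf) _]. unfold dist, dst. split.
  - intros (p & ->%is_opairE & H). apply (app_val _ _ Hf) in H. rewrite opair_prd in H. tauto.
  - intros (Hx & Hy & ->). exists (opair x y). rewrite is_opairE. split; [reflexivity |].
    apply (app_val _ _ Hf). rewrite opair_prd. auto.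
Qed.

Lemma dst_real (x y : M) : x ∈ X -> y ∈ X -> is_real E (dst d x y).
Proof. intros Hx Hy. apply (proj1 (proj2 Hd) x y). apply distE. auto. Qed.

Lemma dst_self (x : M) : x ∈ X -> frac_zero ∉ dst d x x.
Proof.
  intros Hx. destruct Hd as (_ & _ & _ & Hz & _).
  rewrite (proj2 (Hz x x (dst d x x) (cut frac_zero) (proj2 (distE _ _ _) (conj Hx (conj Hx eq_refl)))
    (proj2 (real_zeroE _) eq_refl)) eq_refl).
  apply frac_zero_notin_cut.
Qed.

Lemma dst_neq (x y : M) : x ∈ X -> y ∈ X -> x <> y ->
  exists n, n ∈ om /\ n <> emp /\ frac_inv n ∈ dst d x y.
Proof.
  intros Hx Hy Hxy. destruct Hd as (_ & _ & Hnn & Hz & _).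
  assert (Hdist : dist E d x y (dst d x y)) by (apply distE; auto).
  assert (H0 : real_zero E (cut frac_zero)) by (apply real_zeroE; reflexivity).
  destruct (Hnn _ _ _ _ Hdist H0) as (_ & _ & Hsub).
  apply NNPP. intros H. apply Hxy, (Hz _ _ _ _ Hdist H0), set_ext. intros q.
  split; [|apply Hsub]. intros Hq. apply NNPP. intros Hq0. apply H.
  exact (real_pos_archimedean (dst_real Hx Hy) Hq Hq0).
Qed.

Lemma dst_sym (x y : M) : x ∈ X -> y ∈ X -> dst d x y = dst d y x.
Proof.
  intros Hx Hy. destruct Hd as (_ & _ & _ & _ & Hsym & _).
  apply (distE y x (dst d x y)), Hsym, distE. auto.
Qed.

(** The triangle inequality without real addition: d(x, y) ≤ q and d(y, z) ≤ 1/n give d(x, z) ≤ q',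
    with n independent of the points. *)
Lemma dst_triangle (q q' : M) : frac_lt E q q' -> exists n, n ∈ om /\ n <> emp /\
  forall x y z, x ∈ X -> y ∈ X -> z ∈ X ->
    q ∉ dst d x y -> frac_inv n ∉ dst d y z -> q' ∉ dst d x z.
Proof.
  intros H. destruct (frac_add_small H) as (n & Hn & Hn0 & Hadd).
  exists n. do 2 (split; [assumption |]). intros x y z Hx Hy Hz Hxy Hyz Hxz.
  pose proof (dst_real Hx Hy) as Hr. pose proof (dst_real Hy Hz) as Hs.
  destruct (real_add_exists Hr Hs) as (u & Hu & Huq).
  destruct Hd as (_ & _ & _ & _ & _ & Htri).
  destruct (Htri x y z (dst d x z) (dst d x y) (dst d y z) u) as (_ & _ & Hsub);
    [apply distE; auto .. | exact Hu |].
  destruct (Huq q' (Hsub q' Hxz)) as (a & b & c & Ha & Hb & Hc & Hq').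
  apply (Hadd a b c); [exact (is_real_frac Hr Ha) | | | exact Hc | exact Hq'].
  - intros G. apply Hxy, (is_real_below Hr Ha G).
  - apply (is_real_lt_le Hs Hb); [apply is_frac_inv; assumption | exact Hyz].
Qed.

Lemma metric_open_iff (U : M) : metric_open X d U <-> subset E U X /\
  forall x, x ∈ U -> exists z e, real_zero E z /\ real_lt E z e /\
    forall y r, y ∈ X -> dist E d x y r -> real_lt E r e -> y ∈ U.
Proof.
  assert (H0 : is_real E (cut frac_zero)) by apply is_real_cut, is_frac_zero.
  split; intros [HU H]; (split; [exact HU |]); intros x Hx; pose proof (HU x Hx) as HxX.
  - destruct (H x Hx) as (n & Hn & Hn0 & Hy).
    assert (Hr : is_real E (cut (frac_inv n))) by (apply is_real_cut, is_frac_inv; assumption).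
    (* The open ball of radius 1/n lies in the closed one. *)
    exists (cut frac_zero), (cut (frac_inv n)). split; [apply real_zeroE; reflexivity |].
    split.
    + apply real_lt_iff; auto. exists frac_zero.
      split; [apply cutP, frac_inv_pos; assumption | apply frac_zero_notin_cut].
    + intros y r HyX (_ & _ & ->)%distE [(_ & _ & Hsub) _]. apply Hy; [exact HyX |].
      intros G%Hsub. apply cutP in G. exact (frac_lt_asym G G).
  - destruct (H x Hx) as (z & e & ->%real_zeroE & He & Hy).
    assert (Hr : is_real E e) by (destruct He as [(_ & He & _) _]; exact He).
    apply real_lt_iff in He as (q & Hq & Hq0); auto.
    (* Membership of 1/n in e means 1/n < e, so the closed ball of radius 1/n lies in the open ball
       of radius e. *)
    destruct (real_pos_archimedean Hr Hq Hq0) as (n & Hn & Hn0 & Hne).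
    exists n. do 2 (split; [assumption |]). intros y HyX G.
    apply (Hy y (dst d x y)); [exact HyX | apply distE; auto |].
    apply real_lt_iff; eauto using dst_real.
Qed.

(** The open ball, written as d(x, y) ≤ q < p: the gap between q and p is the room that
    [dst_triangle] needs. *)
Definition ball (x p : M) : M :=
  sep X (fun y => exists q, frac_lt E q p /\ q ∉ dst d x y).

Lemma ballP (x p y : M) :
  y ∈ ball x p <-> y ∈ X /\ exists q, frac_lt E q p /\ q ∉ dst d x y.
Proof. unfold ball. rewrite sepP by definable. tauto. Qed.

Lemma ball_center (x p : M) : x ∈ X -> frac_lt E frac_zero p -> x ∈ ball x p.
Proof. intros Hx Hp. apply ballP. eauto using dst_self. Qed.

Lemma ball_open (x p : M) : x ∈ X -> metric_open X d (ball x p).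
Proof.
  intros Hx. split; [intros y Hy; apply ballP in Hy; tauto |].
  intros y (Hy & q & Hqp & Hq)%ballP. destruct (frac_lt_dense Hqp) as (q' & Hqq' & Hq'p).
  destruct (dst_triangle Hqq') as (n & Hn & Hn0 & Htri).
  exists n. do 2 (split; [assumption |]). intros z Hz Hyz. apply ballP. eauto 6.
Qed.

Lemma metric_topology : topology E X (sep (pow X) (fun U => metric_open X d U)).
Proof.
  assert (HT : forall U, U ∈ sep (pow X) (fun U => metric_open X d U) <-> metric_open X d U).
  { intros U. rewrite sepP by (apply pdef_metric_open; definable). rewrite powP.
    unfold metric_open. tauto. }
  split; [|split; [|split; [|split]]].
  - intros U HU. apply HT in HU. apply HU.
  - intros e ->%is_emptyE. apply HT. split; intros z Hz; case (empP Hz).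
  - apply HT. split; [intros z; auto |]. intros x Hx. exists (suc emp).
    split; [apply suc_om, emp_om |]. split; [apply suc_neq_emp | auto].
  - intros U V W [HU HUo]%HT [HV HVo]%HT HW. apply HT. split; [intros z [Hz _]%HW; auto |].
    intros x [HxU HxV]%HW. pose proof (HU x HxU) as Hx.
    destruct (HUo x HxU) as (n & Hn & Hn0 & HUn). destruct (HVo x HxV) as (m & Hm & Hm0 & HVm).
    destruct (om_trichotomy Hn Hm) as [H | [-> | H]].
    + exists n. do 2 (split; [assumption |]). intros y Hy Hxy. apply HW. split; [auto |].
      apply HVm; [exact Hy |]. exact (frac_inv_notin_mono (dst_real Hx Hy) Hn Hm0 H Hxy).
    + exists n. do 2 (split; [assumption |]). intros y Hy Hxy. apply HW. auto.
    + exists m. do 2 (split; [assumption |]). intros y Hy Hxy. apply HW. split; [|auto].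
      apply HUn; [exact Hy |]. exact (frac_inv_notin_mono (dst_real Hx Hy) Hm Hn0 H Hxy).
  - intros C U HC HU. apply HT. split.
    + intros x (V & HV & Hx)%HU. apply HC, HT in HV as [HV _]. auto.
    + intros x (V & HV & Hx)%HU. pose proof (HC V HV) as HVT. apply HT in HVT as [_ HVo].
      destruct (HVo x Hx) as (n & Hn & Hn0 & Hy). exists n. do 2 (split; [assumption |]).
      intros y HyX Hxy. apply HU. eauto.
Qed.

Variable T : M.
Hypothesis HT : forall U, U ∈ T <-> metric_open X d U.

Lemma metric_hausdorff : hausdorff E X T.
Proof.
  intros x y Hx Hy Hxy. destruct (dst_neq Hx Hy Hxy) as (n & Hn & Hn0 & Hnxy).
  (* The distance of x and y exceeds 1/n. The radii q and 1/m are taken so small that a common point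
     of the two balls would force it to be at most 1/n. *)
  destruct (frac_lt_dense (frac_inv_pos Hn Hn0)) as (q & Hq & Hqn).
  destruct (dst_triangle Hqn) as (m & Hm & Hm0 & Htri).
  exists (ball x q), (ball y (frac_inv m)).
  split; [apply HT, ball_open, Hx |]. split; [apply HT, ball_open, Hy |].
  split; [apply ball_center; assumption |].
  split; [apply ball_center; [exact Hy | apply frac_inv_pos; assumption] |].
  intros z [(Hz & q1 & Hq1 & Hxz)%ballP (_ & q2 & Hq2 & Hyz)%ballP].
  apply (Htri x z y); try assumption.
  - intros G. apply Hxz, (is_real_below (dst_real Hx Hz) G Hq1).
  - rewrite dst_sym by assumption. intros G.
    apply Hyz, (is_real_below (dst_real Hy Hz) G Hq2).
Qed.

Lemma metric_first_countable : first_countable E X T.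
Proof.
  intros x Hx.
  set (B := sep (pow X) (fun b => exists n, n ∈ om /\ n <> emp /\ b = ball x (frac_inv n))).
  assert (HB : forall b, b ∈ B <-> exists n, n ∈ om /\ n <> emp /\ b = ball x (frac_inv n)).
  { intros b. unfold B. rewrite sepP by (unfold ball; definable). split; [tauto |].
    intros H. split; [|exact H]. destruct H as (n & _ & _ & ->). apply powP.
    intros y Hy. apply ballP in Hy. tauto. }
  (* Different radii may give the same ball, so a ball is numbered by the least n that produces
     it. *)
  set (R := fun b n => n <> emp /\ b = ball x (frac_inv n) /\
    forall k, k ∈ n -> ~ (k <> emp /\ b = ball x (frac_inv k))).
  assert (HR : pdef (fun rho => R (rho 0) (rho 1))) by (unfold R, ball; definable).
  exists B. split; [|split].
  - exists (graph B om R). split; [|split].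
    + apply fun_on_graph; [exact HR |]. intros b Hb. pose proof Hb as Hb'.
      apply HB in Hb' as (n & Hn & Hn0 & Hbn).
      destruct (@om_least (fun n => n <> emp /\ b = ball x (frac_inv n))) with n
        as (m & Hm & [Hm0 Hbm] & Hmin); [unfold ball; definable | exact Hn | auto |].
      exists m. split; [split; [exact Hm | split; auto] |].
      intros k [Hk (Hk0 & Hbk & Hkmin)].
      destruct (om_trichotomy Hm Hk) as [H | [H | H]]; [|auto|].
      * case (Hmin k H). auto.
      * case (Hkmin m H). auto.
    + intros b b' n (_ & _ & _ & -> & _)%(app_graph _ _ _ _ HR)
        (_ & _ & _ & -> & _)%(app_graph _ _ _ _ HR). reflexivity.
    + intros b n (_ & Hn & _)%(app_graph _ _ _ _ HR). apply is_natE, Hn.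
  - intros U (n & Hn & Hn0 & ->)%HB. split; [apply HT, ball_open, Hx |].
    apply ball_center; [exact Hx | apply frac_inv_pos; assumption].
  - intros V HV HxV. apply HT in HV as [_ HV].
    destruct (HV x HxV) as (n & Hn & Hn0 & H). exists (ball x (frac_inv n)).
    split; [apply HB; eauto |]. intros y (Hy & q & Hq & Hxy)%ballP. apply H; [exact Hy |].
    intros G. apply Hxy, (is_real_below (dst_real Hx Hy) G Hq).
Qed.

End Metric.

Lemma metrizable_first_countable (X T : M) :
  metrizable E X T -> topology E X T /\ hausdorff E X T /\ first_countable E X T.
Proof.
  intros (HT & d & Hd & HU).
  assert (H : forall U, U ∈ T <-> metric_open X d U).
  { intros U. rewrite (HU U), (metric_open_iff Hd). reflexivity. }
  split; [exact HT |]. split; [exact (metric_hausdorff Hd H) | exact (metric_first_countable Hd H)].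
Qed.

(** * Sums of cuts *)

Lemma real_add_real (s t u : M) : real_add E s t u -> is_real E u.
Proof.
  intros (Hs & Ht & Hu).
  pose proof Hs as (_ & [x Hx] & (p & Hp & Hps) & _).
  pose proof Ht as (_ & [y Hy] & (q & Hq & Hqt) & _).
  destruct (frac_add_exists (is_real_frac Hs Hx) (is_real_frac Ht Hy)) as (z & _ & Hz).
  destruct (frac_add_exists Hp Hq) as (w & Hw & Hpq).
  apply (is_real_sup (I := fun z => exists x y, x ∈ s /\ y ∈ t /\ frac_add E x y z)
    (p0 := z) (p1 := w)).
  - eauto.
  - intros z' (x' & y' & _ & _ & H). apply (frac_add_is_frac H).
  - exact Hw.
  - intros z' (x' & y' & Hx' & Hy' & H). apply (frac_add_le Hp Hq (x := x') (y := y')); auto.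
    + intros G. apply Hps, (is_real_below Hs Hx' G).
    + intros G. apply Hqt, (is_real_below Ht Hy' G).
  - intros q'. rewrite (Hu q'). split.
    + intros (x' & y' & z' & H1 & H2 & H3 & H4). exists z'. eauto 6.
    + intros (z' & (x' & y' & H1 & H2 & H3) & H4). exists x', y', z'. auto.
Qed.

(** The zero cut contains negative fractions only, so t need not contain 0. To reach q, one first
    climbs twice inside s and then adds a negative member of t. *)
Lemma real_add_ge_l (s t u : M) :
  real_add E s t u -> subset E (cut frac_zero) t -> subset E s u.
Proof.
  intros (Hs & Ht & Hu) H0 q Hq. apply Hu.
  destruct (is_real_no_max Hs Hq) as (q1 & Hq1 & H).
  destruct (is_real_no_max Hs Hq1) as (q2 & Hq2 & G).
  destruct (frac_add_neg H G) as (y & z & Hy & Hz & Hqz).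
  exists q2, y, z. split; [exact Hq2 |]. split; [apply H0, cutP, Hy | auto].
Qed.

Lemma real_add_ge_r (s t u : M) :
  real_add E s t u -> subset E (cut frac_zero) s -> subset E t u.
Proof.
  intros (Hs & Ht & Hu) H0. apply (real_add_ge_l (t := s)); [|exact H0].
  do 2 (split; [assumption |]). intros q. rewrite (Hu q).
  split; intros (x & y & z & Hx & Hy & Hz & Hq); exists y, x, z; auto using frac_add_comm.
Qed.

(** * Multiple choice from a metrizable k-space *)

Section Spider.

(* Points at distinct positions are at distance max (1/m, 1/n), where m and n are their
   levels, with 0 instead of 1/0; the only point of level 0 is the accumulation point. *)
Variables (X : M) (lev : M -> M).
Hypothesis lev_tm : tm (fun rho => lev (rho 0)).
Hypothesis lev_om : forall s, s ∈ X -> lev s ∈ om.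
Hypothesis lev_emp : forall s t, s ∈ X -> t ∈ X -> lev s = emp -> lev t = emp -> s = t.
Hypothesis lev_surj : forall n, n ∈ om -> exists s, s ∈ X /\ lev s = n.

(** The fractions whose maximum is the distance. Listing 0 always and skipping level 0 realizes the
    convention 1/0 = 0, and for s = t only 0 is left. *)
Definition spider_bound (s t p : M) : Prop :=
  p = frac_zero \/
  (s <> t /\ exists n, n ∈ om /\ n <> emp /\ (n = lev s \/ n = lev t) /\ p = frac_inv n).

Definition spider_dist (s t : M) : M :=
  sep fracs (fun q => exists p, spider_bound s t p /\ frac_lt E q p).

Definition spider_rel (p r : M) : Prop := exists s t, p = opair s t /\ r = spider_dist s t.

Definition spider_metric : M := graph (prd X X) (pow fracs) spider_rel.

Lemma spider_distP (s t q : M) :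
  q ∈ spider_dist s t <-> exists p, spider_bound s t p /\ frac_lt E q p.
Proof.
  unfold spider_dist. rewrite sepP by (unfold spider_bound; definable).
  split; [tauto |]. intros H. split; [|exact H].
  destruct H as (p & _ & H). apply is_frac_fracs, (frac_lt_is_frac H).
Qed.

Lemma spider_dist_real (s t : M) : is_real E (spider_dist s t).
Proof.
  apply (is_real_sup (I := spider_bound s t) (p0 := frac_zero) (p1 := frac_inv (suc emp))).
  - left. reflexivity.
  - intros p [-> | (_ & n & Hn & Hn0 & _ & ->)];
      [apply is_frac_zero | apply is_frac_inv; assumption].
  - apply is_frac_inv; [apply suc_om, emp_om | apply suc_neq_emp].
  - intros p [-> | (_ & n & Hn & Hn0 & _ & ->)] H.
    + apply (frac_lt_asym H), frac_inv_pos; [apply suc_om, emp_om | apply suc_neq_emp].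
    + apply frac_inv_lt in H; auto using suc_om, emp_om, suc_neq_emp.
      apply sucP in H as [H | H]; [case (empP H) | contradiction].
  - intros q. apply spider_distP.
Qed.

Lemma spider_dist_ge (s t : M) : subset E (cut frac_zero) (spider_dist s t).
Proof. intros q Hq%cutP. apply spider_distP. exists frac_zero. unfold spider_bound. auto. Qed.

Lemma spider_dist_self (s : M) : spider_dist s s = cut frac_zero.
Proof.
  apply set_ext. intros q. split; [|apply spider_dist_ge].
  intros (p & [-> | [H _]] & Hq)%spider_distP; [apply cutP, Hq | congruence].
Qed.

Lemma frac_inv_spider_dist (s t n : M) : n ∈ om -> n <> emp -> s <> t ->
  frac_inv n ∈ spider_dist s t <->
  exists m, m ∈ n /\ m <> emp /\ (m = lev s \/ m = lev t).
Proof.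
  intros Hn Hn0 Hst. rewrite spider_distP. split.
  - intros (p & [-> | (_ & m & Hm & Hm0 & Hlev & ->)] & H).
    + case (frac_lt_asym H). apply frac_inv_pos; assumption.
    + exists m. apply frac_inv_lt in H; auto.
  - intros (m & Hmn & Hm0 & Hlev). pose proof (mem_om Hn Hmn) as Hm.
    exists (frac_inv m). split; [right; eauto 8 |]. apply frac_inv_lt; auto.
Qed.

Lemma spider_dist_pos (s t : M) : s ∈ X -> t ∈ X -> s <> t -> frac_zero ∈ spider_dist s t.
Proof.
  intros Hs Ht Hst. apply spider_distP.
  destruct (classic (lev s = emp)) as [H | H].
  - exists (frac_inv (lev t)).
    assert (G : lev t <> emp) by (intros G; apply Hst, lev_emp; assumption).
    split; [right; eauto 8 | apply frac_inv_pos; auto].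
  - exists (frac_inv (lev s)). split; [right; eauto 8 | apply frac_inv_pos; auto].
Qed.

Lemma pdef_spider_rel : pdef (fun rho => spider_rel (rho 0) (rho 1)).
Proof. unfold spider_rel, spider_dist, spider_bound. definable. Qed.

Lemma spider_distE (s t r : M) :
  dist E spider_metric s t r <-> s ∈ X /\ t ∈ X /\ r = spider_dist s t.
Proof.
  assert (H : forall p, app E spider_metric p r <-> p ∈ prd X X /\ r ∈ pow fracs /\ spider_rel p r).
  { intros p. apply (app_graph _ _ _ _ pdef_spider_rel). }
  unfold dist. split.
  - intros (p & ->%is_opairE & (Hst & _ & s' & t' & [-> ->]%opair_inj & ->)%H).
    apply opair_prd in Hst. tauto.
  - intros (Hs & Ht & ->). exists (opair s t). rewrite is_opairE, H, opair_prd, powP.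
    split; [reflexivity |]. split; [auto |]. split; [|exists s, t; auto].
    intros q Hq. apply is_frac_fracs, (is_real_frac (spider_dist_real s t) Hq).
Qed.

(** A positive bound for the pair x, z comes from the level of x or of z, hence also bounds x, y or
    y, z. If y is one of the two ends, the pair x, z itself is among these. *)
Lemma spider_dist_ultra (x y z : M) (q : M) :
  q ∈ spider_dist x z -> q ∈ spider_dist x y \/ q ∈ spider_dist y z.
Proof.
  intros (p & Hp & Hq)%spider_distP. rewrite !spider_distP.
  cut (spider_bound x y p \/ spider_bound y z p); [intros [H | H]; eauto |].
  destruct Hp as [-> | (Hxz & n & Hn & Hn0 & Hlev & ->)]; [left; left; reflexivity |].
  destruct (classic (x = y)) as [<- | Hxy]; [right; right; eauto 8 |].
  destruct (classic (y = z)) as [<- | Hyz]; [left; right; eauto 8 |].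
  destruct Hlev; [left | right]; right; eauto 8.
Qed.

Lemma spider_metricP : metric E X spider_metric.
Proof.
  assert (Hr : forall x y r, dist E spider_metric x y r -> is_real E r).
  { intros x y r (_ & _ & ->)%spider_distE. apply spider_dist_real. }
  split; [|split; [exact Hr | split; [|split; [|split]]]].
  - exists (prd X X). split; [apply is_prodE; reflexivity |].
    apply fun_on_graph; [apply pdef_spider_rel |].
    intros p (s & t & Hs & Ht & ->)%prdP. exists (spider_dist s t). split.
    + split; [|exists s, t; auto]. apply powP. intros q Hq.
      apply is_frac_fracs, (is_real_frac (spider_dist_real s t) Hq).
    + intros r (_ & s' & t' & [-> ->]%opair_inj & ->). reflexivity.
  - intros x y r z Hd ->%real_zeroE. split; [apply is_real_cut, is_frac_zero |].
    split; [exact (Hr _ _ _ Hd) |]. apply spider_distE in Hd as (_ & _ & ->).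
    apply spider_dist_ge.
  - intros x y r z (Hx & Hy & ->)%spider_distE ->%real_zeroE. split.
    + intros H. apply NNPP. intros Hxy. apply frac_zero_notin_cut. rewrite <- H.
      apply spider_dist_pos; assumption.
    + intros ->. apply spider_dist_self.
  - intros x y r (Hx & Hy & ->)%spider_distE. apply spider_distE.
    do 2 (split; [assumption |]). apply set_ext. intros q. rewrite !spider_distP.
    split; intros (p & [-> | (H & n & Hn & Hn0 & Hlev & ->)] & Hq); eexists;
      (split; [|exact Hq]); [left; reflexivity | right | left; reflexivity | right];
      (split; [auto |]; exists n; tauto).
  - intros x y z r s t u Hxz Hxy Hyz Hu. split; [exact (Hr _ _ _ Hxz) |].
    split; [exact (real_add_real Hu) |].
    apply spider_distE in Hxz as (_ & _ & ->), Hxy as (_ & _ & ->), Hyz as (_ & _ & ->).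
    intros q [Hq | Hq]%(spider_dist_ultra y).
    + exact (real_add_ge_l Hu (spider_dist_ge _ _) Hq).
    + exact (real_add_ge_r Hu (spider_dist_ge _ _) Hq).
Qed.

Lemma dst_spider (s t : M) : s ∈ X -> t ∈ X -> dst spider_metric s t = spider_dist s t.
Proof.
  intros Hs Ht. symmetry. apply (distE spider_metricP s t). apply spider_distE. auto.
Qed.

Definition spider_topology : M := sep (pow X) (fun U => metric_open X spider_metric U).

Lemma spider_topologyP (U : M) : U ∈ spider_topology <-> metric_open X spider_metric U.
Proof.
  unfold spider_topology. rewrite sepP by (apply pdef_metric_open; definable).
  rewrite powP. unfold metric_open. tauto.
Qed.

Lemma spider_metrizable : metrizable E X spider_topology.
Proof.
  split; [apply metric_topology, spider_metricP |].
  exists spider_metric. split; [apply spider_metricP |]. intros U.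
  rewrite spider_topologyP. apply metric_open_iff, spider_metricP.
Qed.

Lemma spider_open (U : M) : subset E U X ->
  (forall o, o ∈ U -> lev o = emp ->
    exists n, n ∈ om /\ forall s, s ∈ X -> n ∈ lev s -> s ∈ U) ->
  U ∈ spider_topology.
Proof.
  intros HU H. apply spider_topologyP. split; [exact HU |]. intros x HxU.
  pose proof (HU x HxU) as Hx. destruct (classic (lev x = emp)) as [H0 | H0].
  (* A point within 1/(n + 1) of the level-0 point has no nonzero level at most n, so its own level
     exceeds n. *)
  - destruct (H x HxU H0) as (n & Hn & Hs). exists (suc n).
    split; [apply suc_om, Hn |]. split; [apply suc_neq_emp |]. intros y Hy Hxy.
    destruct (classic (x = y)) as [<- | Hne]; [exact HxU |]. apply Hs; [exact Hy |].
    assert (Hy0 : lev y <> emp) by (intros G; apply Hne, lev_emp; assumption).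
    rewrite dst_spider, frac_inv_spider_dist in Hxy by auto using suc_om, suc_neq_emp.
    destruct (om_trichotomy (lev_om Hy) Hn) as [G | G]; [exact G |]. case Hxy.
    exists (lev y). rewrite sucP. intuition auto.
  (* All other points are at distance at least 1/[lev x] from x, so this radius isolates x. *)
  - exists (suc (lev x)). split; [apply suc_om, lev_om, Hx |]. split; [apply suc_neq_emp |].
    intros y Hy Hxy. destruct (classic (x = y)) as [<- | Hne]; [exact HxU |]. case Hxy.
    rewrite dst_spider, frac_inv_spider_dist by auto using suc_om, suc_neq_emp.
    exists (lev x). rewrite sucP. auto.
Qed.

(** K is covered by the open set of all points off level n and the open singletons of its points on
    level n. Each such point lies in its own singleton only, so a finite subcover contains all these
    singletons. *)
Lemma spider_compact (K n : M) : n ∈ om -> n <> emp -> compact E X spider_topology K ->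
  finite E (sep K (fun s => lev s = n)).
Proof.
  intros Hn Hn0 [HK HKc].
  set (V := sep X (fun s => lev s <> n)).
  assert (HV : forall s, s ∈ V <-> s ∈ X /\ lev s <> n).
  { intros s. apply sepP. definable. }
  set (C := sep spider_topology (fun U => U = V \/ exists s, s ∈ K /\ lev s = n /\ U = sing s)).
  assert (HC : forall U, U ∈ C <->
    U ∈ spider_topology /\ (U = V \/ exists s, s ∈ K /\ lev s = n /\ U = sing s)).
  { intros U. apply sepP. definable. }
  destruct (HKc C) as (F & HF & HFf & HFK).
  - intros U HU. apply HC in HU. tauto.
  - intros s Hs. destruct (classic (lev s = n)) as [H | H].
    + exists (sing s). rewrite singP. split; [|reflexivity]. apply HC. split; [|eauto].
      apply spider_open; [intros t ->%singP; auto |]. intros o ->%singP G. congruence.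
    + exists V. split; [|apply HV; auto]. apply HC. split; [|auto].
      apply spider_open; [intros t Ht; apply HV in Ht; tauto |].
      intros o _ _. exists n. split; [exact Hn |]. intros t Ht Hnt. apply HV.
      split; [exact Ht |]. intros <-. exact (mem_irrefl_om Hn Hnt).
  - apply (finite_image (R := fun U s => U = sing s) (F := F)).
    + definable.
    + intros U s s' -> H. apply singP. rewrite <- H. apply singP. reflexivity.
    + exact HFf.
    + intros s Hs. rewrite sepP in Hs by definable. destruct Hs as [Hs Hsn].
      destruct (HFK s Hs) as (U & HU & HsU). exists U. split; [exact HU |].
      apply HF, HC in HU as [_ [-> | (s' & _ & _ & ->)]].
      * apply HV in HsU. tauto.
      * apply singP in HsU as ->. reflexivity.
Qed.

(** The complement A of the centre o is not closed, so A ∩ K is not closed for some compact K. If no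
    level in K exceeded n, then o together with all points beyond level n would be a neighbourhood
    of o missing A ∩ K. *)
Lemma spider_k_space : k_space E X spider_topology ->
  exists K, subset E K X /\
    (forall n, n ∈ om -> n <> emp -> finite E (sep K (fun s => lev s = n))) /\
    forall n, n ∈ om -> exists s, s ∈ K /\ n ∈ lev s.
Proof.
  intros (HT & _ & Hk). destruct (lev_surj emp_om) as (o & Ho & Ho0).
  set (A := sep X (fun s => s <> o)).
  assert (HA : forall s, s ∈ A <-> s ∈ X /\ s <> o).
  { intros s. apply sepP. definable. }
  assert (HAX : subset E A X) by (intros s Hs; apply HA in Hs; tauto).
  assert (HAc : ~ closed E X spider_topology A).
  { intros [_ H]%(closed_local HT). destruct (H o) as (U & HU & HoU & HUA);
      [exact Ho | intros G; apply HA in G; tauto |].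
    apply spider_topologyP in HU as [_ HU]. destruct (HU o HoU) as (n & Hn & Hn0 & Hy).
    destruct (lev_surj Hn) as (s & Hs & Hsn).
    assert (Hos : o <> s) by (intros ->; congruence).
    apply (HUA s); [|apply HA; auto]. apply Hy; [exact Hs |].
    (* A point of level n is at distance exactly 1/n from o, hence still in the closed ball of
       radius 1/n. *)
    rewrite dst_spider, frac_inv_spider_dist by auto.
    intros (m & Hm & Hm0 & [-> | ->]); [congruence |]. rewrite Hsn in Hm.
    exact (mem_irrefl_om Hn Hm). }
  rewrite (Hk A HAX) in HAc. apply not_all_ex_not in HAc as [K HAc].
  apply not_all_ex_not in HAc as [B HAc]. apply imply_to_and in HAc as [HK HAc].
  apply imply_to_and in HAc as [HB HBc]. exists K. split; [apply HK |].
  split; [intros n Hn Hn0; exact (spider_compact Hn Hn0 HK) |].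
  intros n Hn. apply NNPP. intros Hno. apply HBc, (closed_local HT).
  split; [intros s [Hs _]%HB; auto |]. intros x Hx HxB.
  destruct (classic (lev x = emp)) as [H0 | H0].
  - set (U := sep X (fun s => s = o \/ n ∈ lev s)).
    assert (HU : forall s, s ∈ U <-> s ∈ X /\ (s = o \/ n ∈ lev s)).
    { intros s. apply sepP. definable. }
    exists U. split; [|split].
    + apply spider_open; [intros s Hs; apply HU in Hs; tauto |].
      intros o' _ _. exists n. split; [exact Hn |]. intros s Hs Hns. apply HU. auto.
    + apply HU. split; [exact Hx |]. left. apply lev_emp; assumption.
    + intros s [_ [-> | Hns]]%HU [[Hs Hso]%HA HsK]%HB; [congruence |]. apply Hno. eauto.
  - exists (sing x). rewrite singP. split; [|split; [reflexivity |]].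
    + apply spider_open; [intros t ->%singP; exact Hx |]. intros t ->%singP G. congruence.
    + intros z ->%singP. exact HxB.
Qed.

End Spider.

(** * The space of choice functions on initial segments *)

Definition dom (s : M) : M := sep (un (un s)) (fun i => exists b, opair i b ∈ s).

Lemma domP (s i : M) : i ∈ dom s <-> exists b, opair i b ∈ s.
Proof.
  unfold dom. rewrite sepP by definable. split; [tauto |]. intros [b Hb]. split; [|eauto].
  apply unP. exists (sing i). split; [|apply singP; reflexivity].
  apply unP. exists (opair i b). split; [exact Hb | apply upairP; auto].
Qed.

Lemma dom_fun_on (s n : M) : fun_on E s n -> dom s = n.
Proof.
  intros Hs. apply set_ext. intros i. rewrite domP. split.
  - intros [b H%appE]. apply (app_val _ _ Hs) in H. tauto.
  - intros Hi. exists (val s i). apply appE, (app_val _ _ Hs). auto.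
Qed.

Lemma k_space_CMC : (forall X T, metrizable E X T -> k_space E X T) -> CMC E.
Proof.
  intros Hk w A ->%is_omegaE HA HAne.
  (* Two unions take the pairs in A apart and expose the sets A i; the third collects their
     elements. *)
  set (Y := un (un (un A))).
  assert (HY : forall i a b, app E A i a -> b ∈ a -> b ∈ Y).
  { intros i a b H%appE Hb. apply unP. exists a. split; [|exact Hb].
    apply unP. exists (upair i a). split; [|apply upairP; auto].
    apply unP. exists (opair i a). split; [exact H | apply upairP; auto]. }
  set (choice := fun s => forall i b a, opair i b ∈ s -> opair i a ∈ A -> b ∈ a).
  set (X := sep (pow (prd om Y)) (fun s => exists n, n ∈ om /\ fun_on E s n /\ choice s)).
  assert (HX : forall s, s ∈ X <-> subset E s (prd om Y) /\
    exists n, n ∈ om /\ fun_on E s n /\ choice s).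
  { intros s. unfold X. rewrite sepP by (unfold choice; definable). rewrite powP. tauto. }
  assert (HXf : forall s, s ∈ X -> dom s ∈ om /\ fun_on E s (dom s)).
  { intros s (_ & n & Hn & Hs & _)%HX. rewrite (dom_fun_on Hs). auto. }
  assert (Hdom : tm (fun rho => dom (rho 0))) by (unfold dom; definable).
  (* Only existence for each single length is claimed, so extending by one element of A n at a time
     needs no choice. *)
  assert (Hsurj : forall n, n ∈ om -> exists s, s ∈ X /\ dom s = n).
  { apply om_ind.
    - unfold dom. definable.
    - assert (H : fun_on E emp emp) by (split; intros p Hp; case (empP Hp)).
      exists emp. split; [|apply dom_fun_on, H]. apply HX.
      split; [intros p Hp; case (empP Hp) |]. exists emp. split; [apply emp_om |].
      split; [exact H |]. intros i b a Hb. case (empP Hb).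
    - intros n Hn (s & Hs & Hsn). pose proof (proj2 (HXf s Hs)) as Hf. rewrite Hsn in Hf.
      apply HX in Hs as (HsY & m & _ & _ & Hc).
      assert (Ha : app E A n (val A n)) by (apply (app_val _ _ HA); auto).
      destruct (HAne _ _ Ha) as [b Hb].
      pose proof (fun_on_add b Hn Hf) as Hf'. exists (bun s (sing (opair n b))).
      split; [|apply dom_fun_on, Hf']. apply HX. split.
      + intros p [Hp | ->%singP]%bunP; [auto |]. apply opair_prd. eauto.
      + exists (suc n). split; [apply suc_om, Hn |]. split; [exact Hf' |].
        intros i c a [Hic | [-> ->]%singP%opair_inj]%bunP Hia; [exact (Hc i c a Hic Hia) |].
        apply appE in Hia. apply (app_val _ _ HA) in Hia as [_ ->]. exact Hb. }
  assert (Hemp : forall s t, s ∈ X -> t ∈ X -> dom s = emp -> dom t = emp -> s = t).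
  { intros s t Hs Ht Hs0 Ht0. apply HXf in Hs as [_ Hs], Ht as [_ Ht].
    rewrite Hs0 in Hs. rewrite Ht0 in Ht. apply set_ext. intros p.
    split; intros Hp; [apply Hs in Hp | apply Ht in Hp];
      destruct Hp as (i & _ & Hi & _); case (empP Hi). }
  assert (Hom : forall s, s ∈ X -> dom s ∈ om) by (intros s Hs; apply HXf, Hs).
  destruct (spider_k_space Hdom Hom Hemp Hsurj) as (K & HK & HKfin & HKub).
  - apply Hk, spider_metrizable; assumption.
  (* The lengths occurring in K are unbounded but may have gaps, so the least one above n is taken;
     its uniqueness makes R functional. *)
  - set (P := fun n m => n ∈ m /\ exists s, s ∈ K /\ dom s = m).
    set (R := fun n b => exists m, m ∈ om /\ P n m /\ (forall k, k ∈ m -> ~ P n k) /\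
      b = sep Y (fun y => exists s, s ∈ K /\ dom s = m /\ opair n y ∈ s)).
    assert (HR : pdef (fun rho => R (rho 0) (rho 1))) by (unfold R, P, dom; definable).
    exists (graph om (pow Y) R). split.
    + apply fun_on_graph; [exact HR |]. intros n Hn.
      destruct (HKub n Hn) as (s & Hs & Hns).
      destruct (@om_least (P n)) with (dom s) as (m & Hm & HP & Hmin);
        [unfold P, dom; definable | apply HXf, HK, Hs | unfold P; eauto |].
      exists (sep Y (fun y => exists s, s ∈ K /\ dom s = m /\ opair n y ∈ s)). split.
      * split; [|exists m; auto]. apply powP. intros y Hy.
        rewrite sepP in Hy by (unfold dom; definable). tauto.
      * intros b (_ & m' & Hm' & HP' & Hmin' & ->).
        destruct (om_trichotomy Hm Hm') as [H | [-> | H]]; [|reflexivity |].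
        -- case (Hmin m' H HP').
        -- case (Hmin' m H HP).
    + intros n a b Ha (Hn & _ & m & Hm & [Hnm (s & Hs & Hsm)] & _ & ->)%(app_graph _ _ _ _ HR).
      assert (HF : forall y, y ∈ sep Y (fun y => exists s, s ∈ K /\ dom s = m /\ opair n y ∈ s)
        <-> y ∈ Y /\ exists s, s ∈ K /\ dom s = m /\ opair n y ∈ s).
      { intros y. apply sepP. unfold dom. definable. }
      assert (HFa : forall s y, s ∈ X -> opair n y ∈ s -> y ∈ a).
      { intros t y (_ & _ & _ & _ & Hc)%HX Hy. apply (Hc n y a Hy). apply appE, Ha. }
      split; [|split].
      (* Since n is below the length m, a member of K of length m has a value at n. *)
      * rewrite <- Hsm in Hnm. apply domP in Hnm as [y Hy]. exists y. apply HF.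
        split; [|eauto]. apply (HY n a y Ha), (HFa s y); auto.
      (* The selected set is the image of the members of K of length m under evaluation at n; these
         are finitely many because m, having n as an element, is nonzero. *)
      * apply (finite_image (R := fun s y => s ∈ X /\ opair n y ∈ s)
          (F := sep K (fun s => dom s = m))).
        -- definable.
        -- intros t y y' [Ht Hy] [_ Hy']. apply HXf in Ht as [_ Ht].
           apply appE in Hy, Hy'. apply (app_val _ _ Ht) in Hy as [_ ->], Hy' as [_ ->].
           reflexivity.
        -- apply HKfin; [exact Hm |]. intros ->. case (empP Hnm).
        -- intros y (_ & t & Ht & Htm & Hy)%HF. exists t.
           rewrite sepP by (unfold dom; definable). auto.
      * intros y (_ & t & Ht & _ & Hy)%HF. eauto.
Qed.

End Model.

Theorem theorem3p3 : forall (M : Type) (E : M -> M -> Prop), ZF E ->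
  (CMC E <->
     forall X T : M, topology E X T -> hausdorff E X T -> first_countable E X T ->
       k_space E X T) /\
  (CMC E <->
     forall X T : M, metrizable E X T -> k_space E X T).
Proof.
  intros M E HZF.
  assert (H12 : CMC E -> forall X T : M,
    topology E X T -> hausdorff E X T -> first_countable E X T -> k_space E X T).
  { intros H X T HT HH Hfc. apply (CMC_k_space HZF HT H HH Hfc). }
  assert (H23 : (forall X T : M,
    topology E X T -> hausdorff E X T -> first_countable E X T -> k_space E X T) ->
    forall X T : M, metrizable E X T -> k_space E X T).
  { intros H X T (HT & HH & Hfc)%(metrizable_first_countable HZF). auto. }
  pose proof (k_space_CMC HZF). tauto.
Qed.
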